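(* Let $(R,\mathfrak m)$ be a complete (Noetherian) local ring containing a field, with coefficient field $k\subseteq R$, and write $R\cong S/I$ where $S=k[[x_1,\dots,x_n]]$, $n=\dim_k(\mathfrak m/\mathfrak m^2)$ and $I\subseteq(x_1,\dots,x_n)^2$. Let $G=\bigoplus_{i\ge0}\mathfrak m^i/\mathfrak m^{i+1}$ and let $\widehat G$ be its completion at $G_+=\bigoplus_{i>0}\mathfrak m^i/\mathfrak m^{i+1}$. Let $T=S[[t]]$ and let $\hom(I)\subseteq T$ be the homogenization of $I$. Then $\hom(R):=T/\hom(I)$ is a flat $k[[t]]$-algebra with special fiber $$\hom(R)/(t)\cong\widehat G$$ and generic fiber $$\big(\hom(R)\otimes_{k[[t]]}k((t))\big)^{\wedge}\cong\big(R\otimes_k k((t))\big)^{\wedge},$$ where the completions in the last isomorphism are taken on both sides with respect to the extension of the ideal $(x_1,\dots,x_n)$.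
   Context: For $0\neq f\in S$ write $f=\sum_{i\ge o(f)}f_i$ with $f_i\in k[x_1,\dots,x_n]$ homogeneous of degree $i$ and $f_{o(f)}\neq0$, i.e. $o(f)=\max\{i\mid f\in(x_1,\dots,x_n)^i\}$. The homogenization of $f$ is $\hom(f)=\sum_{i\ge o(f)}t^{\,i-o(f)}f_i\in T=S[[t]]$, and the homogenization of an ideal $I\subseteq S$ is the ideal $\hom(I)=(\hom(f)\mid 0\neq f\in I)\subseteq T$. $k((t))=k[[t]][t^{-1}]$. *)

(* Defs.v *)
From HB Require Import structures.
From mathcomp Require Import all_boot all_algebra.
From mathcomp Require Import mathcomp_extra boolp.
From mathcomp Require Import mpoly.
From mathcomp Require Import ring.

Set Implicit Arguments.
Unset Strict Implicit.
Unset Printing Implicit Defensive.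

Import GRing.Theory.

Local Open Scope ring_scope.
Local Open Scope quotient_scope.

Record eqv (T : Type) := Eqv {
  eqv_rel :> T -> T -> Prop;
  eqv_refl : forall x, eqv_rel x x;
  eqv_sym : forall x y, eqv_rel x y -> eqv_rel y x;
  eqv_trans : forall x y z, eqv_rel x y -> eqv_rel y z -> eqv_rel x z }.

Section Quo.
Variables (T : choiceType) (e : eqv T).

Lemma eqv_class_of : equiv_class_of (fun x y : T => `[< e x y >]).
Proof.
split=> [x|x y|y x z].
- exact/asboolP/eqv_refl.
- by apply/idP/idP => /asboolP h; apply/asboolP/eqv_sym.
- by move=> /asboolP h1 /asboolP h2; apply/asboolP/(eqv_trans h1 h2).
Qed.

Definition eqv_equiv := EquivRelPack eqv_class_of.
Definition quo := {eq_quot eqv_equiv}.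
HB.instance Definition _ := Choice.on quo.

Definition cls (x : T) : quo := \pi_({eq_quot eqv_equiv}) x.
Definition rep (q : quo) : T := repr (q : {eq_quot eqv_equiv}).

Lemma repK q : cls (rep q) = q.
Proof. exact: reprK. Qed.

Lemma cls_eq x y : cls x = cls y <-> e x y.
Proof. by split=> [/eqmodP/asboolP|h]//; apply/eqmodP/asboolP. Qed.

Lemma rep_cls x : e (rep (cls x)) x.
Proof. by apply/cls_eq; rewrite repK. Qed.

End Quo.

Record ideal (A : comPzRingType) := Ideal {
  ideal_mem :> A -> Prop;
  ideal_0 : ideal_mem 0;
  ideal_D : forall x y, ideal_mem x -> ideal_mem y -> ideal_mem (x + y);
  ideal_M : forall a x, ideal_mem x -> ideal_mem (a * x) }.

Lemma ideal_N (A : comPzRingType) (I : ideal A) x : I x -> I (- x).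
Proof. by move=> h; rewrite -mulN1r; apply: ideal_M. Qed.

Lemma ideal_B (A : comPzRingType) (I : ideal A) x y : I x -> I y -> I (x - y).
Proof. by move=> hx hy; apply/ideal_D/ideal_N. Qed.

Inductive ideal_span (A : comPzRingType) (P : A -> Prop) : A -> Prop :=
| ideal_span_in x : P x -> ideal_span P x
| ideal_span_0 : ideal_span P 0
| ideal_span_D x y : ideal_span P x -> ideal_span P y -> ideal_span P (x + y)
| ideal_span_M a x : ideal_span P x -> ideal_span P (a * x).

Definition ideal_gen (A : comPzRingType) (P : A -> Prop) : ideal A :=
  Ideal (@ideal_span_0 A P) (@ideal_span_D A P) (@ideal_span_M A P).

Definition ideal_full (A : comPzRingType) : ideal A :=
  @Ideal A (fun _ => True) I (fun _ _ _ _ => I) (fun _ _ _ => I).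

Definition ideal_mul (A : comPzRingType) (I J : ideal A) : ideal A :=
  ideal_gen (fun x => exists a b, I a /\ J b /\ x = a * b).

Fixpoint ideal_pow (A : comPzRingType) (I : ideal A) (j : nat) : ideal A :=
  if j is j'.+1 then ideal_mul I (ideal_pow I j') else ideal_full A.

Definition ideal_ext (A B : comPzRingType) (f : A -> B) (I : ideal A) : ideal B :=
  ideal_gen (fun y => exists x, I x /\ y = f x).

Lemma ideal_pow_mul (A : comPzRingType) (I : ideal A) i j x y :
  ideal_pow I i x -> ideal_pow I j y -> ideal_pow I (i + j)%N (x * y).
Proof.
elim: i x => [|i IH] x /= hx hy; first by rewrite add0n; apply: ideal_M.
elim: hx => [z [a [b [ha [hb ->]]]]|||].
- rewrite -mulrA; apply: ideal_span_in; exists a, (b * y); split=> //; split=> //.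
  exact: IH.
- by rewrite mul0r; apply: ideal_span_0.
- by move=> u v _ h1 _ h2; rewrite mulrDl; apply: ideal_span_D.
- by move=> a u _ h; rewrite -mulrA; apply: ideal_span_M.
Qed.

Lemma ideal_pow1 (A : comPzRingType) (I : ideal A) x : I x -> ideal_pow I 1 x.
Proof.
by move=> h; apply: ideal_span_in; exists x, 1; rewrite mulr1.
Qed.

Lemma ideal_powS (A : comPzRingType) (I : ideal A) j x :
  ideal_pow I j.+1 x -> ideal_pow I j x.
Proof.
elim=> [z [a [b [_ [hb ->]]]]|||].
- exact: ideal_M.
- exact: ideal_0.
- by move=> u v _ h1 _ h2; apply: ideal_D.
- by move=> a u _ h; apply: ideal_M.
Qed.

Section QuotientRing.
Variables (A : comPzRingType) (I : ideal A).

Definition ideal_eqv : eqv A.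
Proof.
refine (@Eqv A (fun x y => I (x - y)) _ _ _).
- by move=> x; rewrite subrr; apply: ideal_0.
- by move=> x y h; rewrite -opprB; apply: ideal_N.
- by move=> x y z h1 h2; rewrite -[x](subrK y) -addrA; apply: ideal_D.
Defined.

Definition quotient := quo ideal_eqv.
HB.instance Definition _ := Choice.on quotient.

Let pi (x : A) : quotient := cls ideal_eqv x.

Lemma quotient_eq x y : cls ideal_eqv x = cls ideal_eqv y <-> I (x - y).
Proof. exact: cls_eq. Qed.

Definition quotient_add (p q : quotient) : quotient := pi (rep p + rep q).
Definition quotient_opp (p : quotient) : quotient := pi (- rep p).
Definition quotient_mul (p q : quotient) : quotient := pi (rep p * rep q).

Lemma quotient_addE x y : quotient_add (pi x) (pi y) = pi (x + y).
Proof.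
apply/quotient_eq; rewrite opprD addrACA.
by apply: ideal_D; apply: (rep_cls ideal_eqv).
Qed.

Lemma quotient_oppE x : quotient_opp (pi x) = pi (- x).
Proof.
by apply/quotient_eq; rewrite -opprD; apply: ideal_N; apply: (rep_cls ideal_eqv).
Qed.

Lemma quotient_mulE x y : quotient_mul (pi x) (pi y) = pi (x * y).
Proof.
apply/quotient_eq; set u := rep _; set v := rep _.
have -> : u * v - x * y = v * (u - x) + x * (v - y).
  by rewrite !mulrBr [v * u]mulrC [v * x]mulrC addrA subrK.
by apply: ideal_D; apply: ideal_M; apply: (rep_cls ideal_eqv).
Qed.

Lemma quotientP (p : quotient) : exists x, p = pi x.
Proof. by exists (rep p); rewrite /pi repK. Qed.

Fact quotient_addA : associative quotient_add.
Proof.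
move=> p q r; have [x ->] := quotientP p; have [y ->] := quotientP q.
by have [z ->] := quotientP r; rewrite !quotient_addE addrA.
Qed.
Fact quotient_addC : commutative quotient_add.
Proof. by move=> p q; rewrite /quotient_add addrC. Qed.
Fact quotient_add0 : left_id (pi 0) quotient_add.
Proof. by move=> p; have [x ->] := quotientP p; rewrite quotient_addE add0r. Qed.
Fact quotient_addN : left_inverse (pi 0) quotient_opp quotient_add.
Proof.
by move=> p; have [x ->] := quotientP p; rewrite quotient_oppE quotient_addE addNr.
Qed.
HB.instance Definition _ := GRing.isZmodule.Build quotient
  quotient_addA quotient_addC quotient_add0 quotient_addN.

Fact quotient_mulA : associative quotient_mul.
Proof.
move=> p q r; have [x ->] := quotientP p; have [y ->] := quotientP q.
by have [z ->] := quotientP r; rewrite !quotient_mulE mulrA.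
Qed.
Fact quotient_mulC : commutative quotient_mul.
Proof. by move=> p q; rewrite /quotient_mul mulrC. Qed.
Fact quotient_mul1 : left_id (pi 1) quotient_mul.
Proof. by move=> p; have [x ->] := quotientP p; rewrite quotient_mulE mul1r. Qed.
Fact quotient_mulD : left_distributive quotient_mul +%R.
Proof.
move=> p q r; have [x ->] := quotientP p; have [y ->] := quotientP q.
have [z ->] := quotientP r; rewrite /GRing.add /= !(quotient_mulE, quotient_addE).
by rewrite mulrDl.
Qed.
HB.instance Definition _ := GRing.Zmodule_isComPzRing.Build quotient
  quotient_mulA quotient_mulC quotient_mul1 quotient_mulD.

Definition proj (x : A) : quotient := pi x.

Fact proj_zmod : zmod_morphism proj.
Proof. by move=> x y; rewrite /proj -quotient_addE -quotient_oppE. Qed.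
HB.instance Definition _ := GRing.isZmodMorphism.Build A quotient proj proj_zmod.
Fact proj_monoid : monoid_morphism proj.
Proof. by split=> // x y; rewrite /proj -quotient_mulE. Qed.
HB.instance Definition _ := GRing.isMonoidMorphism.Build A quotient proj proj_monoid.

Lemma proj_eq x y : proj x = proj y <-> I (x - y).
Proof. exact: quotient_eq. Qed.

Lemma proj_surj p : exists x, proj x = p.
Proof. by exists (rep p); apply: repK. Qed.

End QuotientRing.

(* Adic completion: the inverse limit of the rings A / J^j. *)

Section Product.
Variable F : nat -> comPzRingType.

Definition prod_ring := forall j, F j.
HB.instance Definition _ := gen_eqMixin prod_ring.
HB.instance Definition _ := gen_choiceMixin prod_ring.

Let padd (u v : prod_ring) : prod_ring := fun j => u j + v j.
Let pmul (u v : prod_ring) : prod_ring := fun j => u j * v j.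
Let popp (u : prod_ring) : prod_ring := fun j => - u j.

Fact prod_ring_addA : associative padd.
Proof. by move=> u v w; apply: functional_extensionality_dep => j; apply: addrA. Qed.
Fact prod_ring_addC : commutative padd.
Proof. by move=> u v; apply: functional_extensionality_dep => j; apply: addrC. Qed.
Fact prod_ring_add0 : left_id (fun j => 0 : F j) padd.
Proof. by move=> u; apply: functional_extensionality_dep => j; apply: add0r. Qed.
Fact prod_ring_addN : left_inverse (fun j => 0 : F j) popp padd.
Proof. by move=> u; apply: functional_extensionality_dep => j; apply: addNr. Qed.
HB.instance Definition _ := GRing.isZmodule.Build prod_ring
  prod_ring_addA prod_ring_addC prod_ring_add0 prod_ring_addN.

Fact prod_ring_mulA : associative pmul.
Proof. by move=> u v w; apply: functional_extensionality_dep => j; apply: mulrA. Qed.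
Fact prod_ring_mulC : commutative pmul.
Proof. by move=> u v; apply: functional_extensionality_dep => j; apply: mulrC. Qed.
Fact prod_ring_mul1 : left_id (fun j => 1 : F j) pmul.
Proof. by move=> u; apply: functional_extensionality_dep => j; apply: mul1r. Qed.
Fact prod_ring_mulD : left_distributive pmul +%R.
Proof. by move=> u v w; apply: functional_extensionality_dep => j; apply: mulrDl. Qed.
HB.instance Definition _ := GRing.Zmodule_isComPzRing.Build prod_ring
  prod_ring_mulA prod_ring_mulC prod_ring_mul1 prod_ring_mulD.

End Product.

Section Completion.
Variables (A : comPzRingType) (J : ideal A).

(* A / J^(j+1) -> A / J^j *)
Definition transition j (p : quotient (ideal_pow J j.+1)) :
  quotient (ideal_pow J j) := proj (ideal_pow J j) (rep p).

Lemma transitionE j x :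
  transition (proj (ideal_pow J j.+1) x) = proj (ideal_pow J j) x.
Proof.
apply/proj_eq/ideal_powS/quotient_eq.
by rewrite repK.
Qed.

Fact transition_zmod j : zmod_morphism (@transition j).
Proof.
move=> p q; have [x <-] := proj_surj p; have [y <-] := proj_surj q.
by rewrite -rmorphB !transitionE rmorphB.
Qed.
HB.instance Definition _ j := GRing.isZmodMorphism.Build _ _ (@transition j)
  (@transition_zmod j).
Fact transition_monoid j : monoid_morphism (@transition j).
Proof.
split; first by rewrite -(rmorph1 (proj _)) transitionE rmorph1.
move=> p q; have [x <-] := proj_surj p; have [y <-] := proj_surj q.
by rewrite -rmorphM !transitionE rmorphM.
Qed.
HB.instance Definition _ j := GRing.isMonoidMorphism.Build _ _ (@transition j)
  (@transition_monoid j).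

Definition compatible : {pred prod_ring (fun j => quotient (ideal_pow J j))} :=
  fun u => `[< forall j, transition (u j.+1) = u j >].

Fact compatible_subring : subring_closed compatible.
Proof.
split.
- by apply/asboolP => j; apply: rmorph1.
- move=> u v /asboolP hu /asboolP hv; apply/asboolP => j.
  by apply: etrans (rmorphB _ _ _) _; congr (_ - _); [exact: hu | exact: hv].
- move=> u v /asboolP hu /asboolP hv; apply/asboolP => j.
  by apply: etrans (rmorphM _ _ _) _; congr (_ * _); [exact: hu | exact: hv].
Qed.
HB.instance Definition _ := GRing.isSubringClosed.Build _ compatible
  compatible_subring.

Record completion := Completion {
  completion_val :> prod_ring (fun j => quotient (ideal_pow J j));
  completionP : completion_val \in compatible }.

HB.instance Definition _ := [isSub for completion_val].
HB.instance Definition _ := [Choice of completion by <:].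
HB.instance Definition _ :=
  GRing.SubChoice_isSubComPzRing.Build _ _ completion compatible_subring.

Fact to_completion_compat x :
  (fun j => proj (ideal_pow J j) x) \in compatible.
Proof. by apply/asboolP => j; apply: transitionE. Qed.

Definition to_completion (x : A) : completion :=
  Completion (to_completion_compat x).

Fact to_completion_zmod : zmod_morphism to_completion.
Proof.
by move=> x y; apply: val_inj; apply: functional_extensionality_dep => j; apply: rmorphB.
Qed.
HB.instance Definition _ := GRing.isZmodMorphism.Build A completion to_completion
  to_completion_zmod.
Fact to_completion_monoid : monoid_morphism to_completion.
Proof.
split=> [|x y]; apply: val_inj; apply: functional_extensionality_dep => j.
  exact: rmorph1.
exact: rmorphM.
Qed.
HB.instance Definition _ := GRing.isMonoidMorphism.Build A completion to_completion
  to_completion_monoid.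

End Completion.

(* The localization A[1/a] at the powers of a: fractions f / a^i. *)

Section Localization.
Variables (A : comPzRingType) (a : A).

Definition loc_eqv : eqv (A * nat).
Proof.
refine (@Eqv (A * nat) (fun x y =>
  exists l, a ^+ l * (a ^+ y.2 * x.1 - a ^+ x.2 * y.1) = 0) _ _ _).
- by move=> x; exists 0%N; rewrite subrr mulr0.
- by move=> x y [l h]; exists l; rewrite -opprB mulrN h oppr0.
- move=> [x i] [y j] [z m] /= [l h] [p h']; exists (l + p + j)%N.
  have -> : a ^+ (l + p + j) * (a ^+ m * x - a ^+ i * z) =
     a ^+ p * a ^+ m * (a ^+ l * (a ^+ j * x - a ^+ i * y)) +
     a ^+ l * a ^+ i * (a ^+ p * (a ^+ m * y - a ^+ j * z)).
    by rewrite !exprD; ring.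
  by rewrite h h' !mulr0 addr0.
Defined.


Definition loc := quo loc_eqv.
HB.instance Definition _ := Choice.on loc.

Definition frac (x : A) (i : nat) : loc := cls loc_eqv (x, i).

Lemma frac_eq x i y j :
  frac x i = frac y j <-> exists l, a ^+ l * (a ^+ j * x - a ^+ i * y) = 0.
Proof. exact: cls_eq. Qed.

Lemma fracP p : exists x i, p = frac x i.
Proof. by exists (rep p).1, (rep p).2; rewrite /frac -surjective_pairing repK. Qed.

Definition loc_add (p q : loc) : loc := let x := rep p in let y := rep q in
  frac (a ^+ y.2 * x.1 + a ^+ x.2 * y.1) (x.2 + y.2).
Definition loc_opp (p : loc) : loc := frac (- (rep p).1) (rep p).2.
Definition loc_mul (p q : loc) : loc := let x := rep p in let y := rep q in
  frac (x.1 * y.1) (x.2 + y.2).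

Lemma frac_rep x i : exists l,
  a ^+ l * (a ^+ i * (rep (frac x i)).1 - a ^+ (rep (frac x i)).2 * x) = 0.
Proof. exact: (rep_cls loc_eqv (x, i)). Qed.

Lemma loc_addE x i y j :
  loc_add (frac x i) (frac y j) = frac (a ^+ j * x + a ^+ i * y) (i + j).
Proof.
rewrite /loc_add; apply/frac_eq; have [l] := frac_rep x i; have [m] := frac_rep y j.
case: (rep (frac x i)) => x' i'; case: (rep (frac y j)) => y' j' /= h' h.
exists (l + m)%N; have -> : a ^+ (l + m) *
  (a ^+ (i + j) * (a ^+ j' * x' + a ^+ i' * y') -
   a ^+ (i' + j') * (a ^+ j * x + a ^+ i * y)) =
  a ^+ m * a ^+ j * a ^+ j' * (a ^+ l * (a ^+ i * x' - a ^+ i' * x)) +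
  a ^+ l * a ^+ i * a ^+ i' * (a ^+ m * (a ^+ j * y' - a ^+ j' * y)).
  by rewrite !exprD; ring.
by rewrite h h' !mulr0 addr0.
Qed.

Lemma loc_oppE x i : loc_opp (frac x i) = frac (- x) i.
Proof.
apply/frac_eq; have [l] := frac_rep x i; case: (rep _) => [x' i'] /= h.
by exists l; rewrite !mulrN -opprD mulrN h oppr0.
Qed.

Lemma loc_mulE x i y j : loc_mul (frac x i) (frac y j) = frac (x * y) (i + j).
Proof.
rewrite /loc_mul; apply/frac_eq; have [l] := frac_rep x i; have [m] := frac_rep y j.
case: (rep (frac x i)) => x' i'; case: (rep (frac y j)) => y' j' /= h' h.
exists (l + m)%N; have -> : a ^+ (l + m) *
  (a ^+ (i + j) * (x' * y') - a ^+ (i' + j') * (x * y)) =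
  a ^+ m * a ^+ j * y' * (a ^+ l * (a ^+ i * x' - a ^+ i' * x)) +
  a ^+ l * a ^+ i' * x * (a ^+ m * (a ^+ j * y' - a ^+ j' * y)).
  by rewrite !exprD; ring.
by rewrite h h' !mulr0 addr0.
Qed.

Fact loc_addA : associative loc_add.
Proof.
move=> p q r; have [x [i ->]] := fracP p; have [y [j ->]] := fracP q.
have [z [m ->]] := fracP r; rewrite !loc_addE addnA; congr frac.
by rewrite !exprD; ring.
Qed.
Fact loc_addC : commutative loc_add.
Proof. by move=> p q; rewrite /loc_add addrC addnC. Qed.
Fact loc_add0 : left_id (frac 0 0) loc_add.
Proof.
move=> p; have [x [i ->]] := fracP p.
by rewrite loc_addE mulr0 add0r expr0 mul1r.
Qed.
Fact loc_addN : left_inverse (frac 0 0) loc_opp loc_add.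
Proof.
move=> p; have [x [i ->]] := fracP p; rewrite loc_oppE loc_addE.
by apply/frac_eq; exists 0%N; ring.
Qed.
HB.instance Definition _ := GRing.isZmodule.Build loc
  loc_addA loc_addC loc_add0 loc_addN.

Fact loc_mulA : associative loc_mul.
Proof.
move=> p q r; have [x [i ->]] := fracP p; have [y [j ->]] := fracP q.
by have [z [m ->]] := fracP r; rewrite !loc_mulE addnA mulrA.
Qed.
Fact loc_mulC : commutative loc_mul.
Proof. by move=> p q; rewrite /loc_mul mulrC addnC. Qed.
Fact loc_mul1 : left_id (frac 1 0) loc_mul.
Proof. by move=> p; have [x [i ->]] := fracP p; rewrite loc_mulE mul1r. Qed.
Fact loc_mulD : left_distributive loc_mul loc_add.
Proof.
move=> p q r; have [x [i ->]] := fracP p; have [y [j ->]] := fracP q.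
have [z [m ->]] := fracP r; rewrite !(loc_mulE, loc_addE); apply/frac_eq.
by exists 0%N; rewrite !exprD; ring.
Qed.
HB.instance Definition _ := GRing.Zmodule_isComPzRing.Build loc
  loc_mulA loc_mulC loc_mul1 loc_mulD.

Definition to_loc (x : A) : loc := frac x 0.

Fact to_loc_zmod : zmod_morphism to_loc.
Proof.
move=> x y; rewrite [RHS](_ : _ = loc_add (to_loc x) (loc_opp (to_loc y))) //.
by rewrite loc_oppE loc_addE expr0 !mul1r.
Qed.
HB.instance Definition _ := GRing.isZmodMorphism.Build A loc to_loc to_loc_zmod.
Fact to_loc_monoid : monoid_morphism to_loc.
Proof. by split=> // x y; rewrite /to_loc [RHS]loc_mulE. Qed.
HB.instance Definition _ := GRing.isMonoidMorphism.Build A loc to_loc to_loc_monoid.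

End Localization.

(* Tensor product of modules: finite formal sums of pure tensors, modulo the
   congruence generated by bilinearity.  The inverse of (m, n) is (- m, n), so
   the quotient of the free commutative monoid is already a group. *)

Section Tensor.
Variables (A : comPzRingType) (M N : lmodType A).

Inductive tensor_rel : seq (M * N) -> seq (M * N) -> Prop :=
| tensor_refl s : tensor_rel s s
| tensor_sym s s' : tensor_rel s s' -> tensor_rel s' s
| tensor_trans s s' s'' :
    tensor_rel s s' -> tensor_rel s' s'' -> tensor_rel s s''
| tensor_cat s1 s1' s2 s2' : tensor_rel s1 s1' -> tensor_rel s2 s2' ->
    tensor_rel (s1 ++ s2) (s1' ++ s2')
| tensor_comm s1 s2 : tensor_rel (s1 ++ s2) (s2 ++ s1)
| tensor_zero n : tensor_rel [:: (0, n)] [::]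
| tensor_addl m m' n : tensor_rel [:: (m + m', n)] [:: (m, n); (m', n)]
| tensor_addr m n n' : tensor_rel [:: (m, n + n')] [:: (m, n); (m, n')]
| tensor_scale a m n : tensor_rel [:: (a *: m, n)] [:: (m, a *: n)].

Definition tensor_eqv : eqv (seq (M * N)) :=
  Eqv tensor_refl tensor_sym tensor_trans.

Definition tensor := quo tensor_eqv.
HB.instance Definition _ := Choice.on tensor.

Let pi (s : seq (M * N)) : tensor := cls tensor_eqv s.

Definition tensor_add (p q : tensor) : tensor := pi (rep p ++ rep q).
Definition tensor_opp (p : tensor) : tensor :=
  pi [seq (- x.1, x.2) | x <- rep p].

Lemma tensor_addE s s' : tensor_add (pi s) (pi s') = pi (s ++ s').
Proof. by apply/cls_eq/tensor_cat; apply: (rep_cls tensor_eqv). Qed.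

Lemma tensor_subr s : tensor_rel ([seq (- x.1, x.2) | x <- s] ++ s) [::].
Proof.
elim: s => [|[m n] s IH] /=; first exact: tensor_refl.
set ns := map _ _ in IH *; set x := (- m, n); set y := (m, n).
apply: (@tensor_trans _ ([:: x; y] ++ (ns ++ s))).
  apply: (@tensor_cat [:: x] [:: x] (ns ++ [:: y] ++ s) ([:: y] ++ ns ++ s)).
    exact: tensor_refl.
  rewrite [X in tensor_rel X]catA [X in tensor_rel _ X]catA.
  by apply: tensor_cat; [exact: tensor_comm | exact: tensor_refl].
rewrite -[X in tensor_rel _ X]cats0; apply: tensor_cat IH.
apply: tensor_trans (tensor_zero n); rewrite -(addNr m).
exact/tensor_sym/tensor_addl.
Qed.

Fact tensor_addA : associative tensor_add.
Proof.
move=> p q r; rewrite -(repK p) -(repK q) -(repK r) -!/(pi _).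
by rewrite !tensor_addE catA.
Qed.
Fact tensor_addC : commutative tensor_add.
Proof. by move=> p q; apply/cls_eq/tensor_comm. Qed.
Fact tensor_add0 : left_id (pi [::]) tensor_add.
Proof. by move=> p; rewrite -(repK p) -/(pi _) tensor_addE. Qed.
Fact tensor_addN : left_inverse (pi [::]) tensor_opp tensor_add.
Proof.
move=> p; rewrite -[p in X in tensor_add _ X](repK p) -/(pi _) tensor_addE.
exact/cls_eq/tensor_subr.
Qed.
HB.instance Definition _ := GRing.isZmodule.Build tensor
  tensor_addA tensor_addC tensor_add0 tensor_addN.

Definition pure_tensor (m : M) (n : N) : tensor := pi [:: (m, n)].

Lemma pureDl m m' n : pure_tensor (m + m') n = pure_tensor m n + pure_tensor m' n.
Proof.
rewrite [RHS](_ : _ = tensor_add (pure_tensor m n) (pure_tensor m' n)) // tensor_addE.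
exact/cls_eq/tensor_addl.
Qed.

Lemma pureDr m n n' : pure_tensor m (n + n') = pure_tensor m n + pure_tensor m n'.
Proof.
rewrite [RHS](_ : _ = tensor_add (pure_tensor m n) (pure_tensor m n')) // tensor_addE.
exact/cls_eq/tensor_addr.
Qed.

Lemma pureZ a m n : pure_tensor (a *: m) n = pure_tensor m (a *: n).
Proof. exact/cls_eq/tensor_scale. Qed.

Lemma tensor_sum s : pi s = \sum_(x <- s) pure_tensor x.1 x.2.
Proof.
elim: s => [|[m n] s IH]; first by rewrite big_nil.
rewrite big_cons -IH /=.
by rewrite [RHS](_ : _ = tensor_add (pure_tensor m n) (pi s)) // tensor_addE.
Qed.

Lemma tensor_rep p : p = \sum_(x <- rep p) pure_tensor x.1 x.2.
Proof. by rewrite -tensor_sum /pi repK. Qed.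

Lemma tensor_ind (P : tensor -> Prop) : P 0 ->
  (forall p q, P p -> P q -> P (p + q)) -> (forall m n, P (pure_tensor m n)) ->
  forall p, P p.
Proof. by move=> h0 hD h p; rewrite (tensor_rep p); apply: big_ind. Qed.

Section Lift.
Variables (Z : zmodType) (g : M -> N -> Z).
Hypothesis gDl : forall m m' n, g (m + m') n = g m n + g m' n.
Hypothesis gDr : forall m n n', g m (n + n') = g m n + g m n'.
Hypothesis gZ : forall a m n, g (a *: m) n = g m (a *: n).

Definition tensor_lift (p : tensor) : Z := \sum_(x <- rep p) g x.1 x.2.

Lemma tensor_lift_pi s : tensor_lift (pi s) = \sum_(x <- s) g x.1 x.2.
Proof.
rewrite /tensor_lift; move: (rep _) (rep_cls tensor_eqv s) => s' /= h.
elim: h => {s s'} //.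
- by move=> ? ? ? _ -> _ ->.
- by move=> ? ? ? ? _ h1 _ h2; rewrite !big_cat /= h1 h2.
- by move=> ? ?; rewrite !big_cat /= addrC.
- move=> n; rewrite big_seq1 big_nil /=; apply: (addrI (g 0 n)).
  by rewrite -gDl !addr0.
- by move=> ? ? ?; rewrite big_seq1 big_cons big_seq1 /= gDl.
- by move=> ? ? ?; rewrite big_seq1 big_cons big_seq1 /= gDr.
- by move=> ? ? ?; rewrite !big_seq1 /= gZ.
Qed.

Lemma tensor_liftE m n : tensor_lift (pure_tensor m n) = g m n.
Proof. by rewrite tensor_lift_pi big_seq1. Qed.

Lemma tensor_liftD p q : tensor_lift (p + q) = tensor_lift p + tensor_lift q.
Proof.
rewrite -(repK p) -(repK q) -!/(pi _).
rewrite [X in tensor_lift X](_ : _ = tensor_add (pi (rep p)) (pi (rep q))) //.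
by rewrite tensor_addE !tensor_lift_pi big_cat.
Qed.

Lemma tensor_lift0 : tensor_lift 0 = 0.
Proof. by rewrite [0](_ : _ = pi [::]) // tensor_lift_pi big_nil. Qed.

End Lift.

End Tensor.

Definition tensor_map (A : comPzRingType) (M M' N : lmodType A)
    (f : {linear M -> M'}) : tensor M N -> tensor M' N :=
  tensor_lift (fun m n => pure_tensor (f m) n).

(* B as an A-module through phi : A -> B *)
Definition restr (A B : comPzRingType) (phi : {rmorphism A -> B}) : Type := B.

Section Restriction.
Variables (A B : comPzRingType) (phi : {rmorphism A -> B}).

HB.instance Definition _ := GRing.ComPzRing.on (restr phi).

Let scale (a : A) (b : restr phi) : restr phi := phi a * (b : B).

Fact restr_scaleA a b v : scale a (scale b v) = scale (a * b) v.
Proof. by rewrite /scale rmorphM mulrA. Qed.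
Fact restr_scale1 : left_id 1 scale.
Proof. by move=> v; rewrite /scale rmorph1 mul1r. Qed.
Fact restr_scaleDr : right_distributive scale +%R.
Proof. by move=> a u v; apply: mulrDr. Qed.
Fact restr_scaleDl v : {morph scale^~ v : a b / a + b}.
Proof. by move=> a b; rewrite /scale rmorphD mulrDl. Qed.
HB.instance Definition _ := GRing.Zmodule_isLmodule.Build A (restr phi)
  restr_scaleA restr_scale1 restr_scaleDr restr_scaleDl.

Definition flat := forall (M N : lmodType A) (f : {linear M -> N}),
  injective f -> injective (tensor_map (N := restr phi) f).

End Restriction.

(* The ring B (x)_A C, for ring morphisms A -> B and A -> C. *)

Section TensorRing.
Variables (A B C : comPzRingType).
Variables (phi : {rmorphism A -> B}) (psi : {rmorphism A -> C}).

Definition tensor_ring := tensor (restr phi) (restr psi).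
HB.instance Definition _ := GRing.Zmodule.on tensor_ring.

Definition tpure (b : B) (c : C) : tensor_ring :=
  pure_tensor (b : restr phi) (c : restr psi).

Lemma tpureDl b b' c : tpure (b + b') c = tpure b c + tpure b' c.
Proof. exact: (@pureDl A (restr phi) (restr psi)). Qed.
Lemma tpureDr b c c' : tpure b (c + c') = tpure b c + tpure b c'.
Proof. exact: (@pureDr A (restr phi) (restr psi)). Qed.
Lemma tpureZ a b c : tpure (phi a * b) c = tpure b (psi a * c).
Proof. exact: (@pureZ A (restr phi) (restr psi) a b c). Qed.

Lemma tensor_ring_ind (P : tensor_ring -> Prop) : P 0 ->
  (forall p q, P p -> P q -> P (p + q)) -> (forall b c, P (tpure b c)) ->
  forall p, P p.
Proof. exact: (@tensor_ind A (restr phi) (restr psi)). Qed.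

Definition tensor_mull (b : B) (c : C) : tensor_ring -> tensor_ring :=
  @tensor_lift A (restr phi) (restr psi) tensor_ring
    (fun (b' : B) (c' : C) => tpure (b * b') (c * c')).

Definition tensor_mul (p q : tensor_ring) : tensor_ring :=
  @tensor_lift A (restr phi) (restr psi) tensor_ring
    (fun (b : B) (c : C) => tensor_mull b c q) p.

Let mull_Dl (b : B) (c : C) : forall x y z,
  tpure (b * (x + y)) (c * z) = tpure (b * x) (c * z) + tpure (b * y) (c * z).
Proof. by move=> x y z; rewrite mulrDr tpureDl. Qed.
Let mull_Dr (b : B) (c : C) : forall x y z,
  tpure (b * x) (c * (y + z)) = tpure (b * x) (c * y) + tpure (b * x) (c * z).
Proof. by move=> x y z; rewrite mulrDr tpureDr. Qed.
Let mull_Z b c : forall a x y,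
  tpure (b * (phi a * x)) (c * y) = tpure (b * x) (c * (psi a * y)).
Proof. by move=> a x y; rewrite mulrCA tpureZ mulrCA. Qed.

Lemma tensor_mull_pure b c b' c' :
  tensor_mull b c (tpure b' c') = tpure (b * b') (c * c').
Proof.
by apply: (@tensor_liftE A (restr phi) (restr psi)) => *;
  [apply: mull_Dl | apply: mull_Dr | apply: mull_Z].
Qed.

Lemma tensor_mullD b c p q :
  tensor_mull b c (p + q) = tensor_mull b c p + tensor_mull b c q.
Proof.
by apply: (@tensor_liftD A (restr phi) (restr psi)) => *;
  [apply: mull_Dl | apply: mull_Dr | apply: mull_Z].
Qed.

Lemma tensor_mull0 b c : tensor_mull b c 0 = 0.
Proof.
by apply: (@tensor_lift0 A (restr phi) (restr psi)) => *;
  [apply: mull_Dl | apply: mull_Dr | apply: mull_Z].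
Qed.

Let mulg_Dl b b' c q :
  tensor_mull (b + b') c q = tensor_mull b c q + tensor_mull b' c q.
Proof.
rewrite -big_split; apply: eq_bigr => x _ /=.
by rewrite mulrDl tpureDl.
Qed.
Let mulg_Dr b c c' q :
  tensor_mull b (c + c') q = tensor_mull b c q + tensor_mull b c' q.
Proof.
rewrite -big_split; apply: eq_bigr => x _ /=.
by rewrite mulrDl tpureDr.
Qed.
Let mulg_Z a b c q : tensor_mull (phi a * b) c q = tensor_mull b (psi a * c) q.
Proof. by apply: eq_bigr => x _ /=; rewrite -!mulrA tpureZ. Qed.

Lemma tensor_mul_purel b c q : tensor_mul (tpure b c) q = tensor_mull b c q.
Proof.
by apply: (@tensor_liftE A (restr phi) (restr psi)) => *;
  [apply: mulg_Dl | apply: mulg_Dr | apply: mulg_Z].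
Qed.

Lemma tensor_mul_pure b c b' c' :
  tensor_mul (tpure b c) (tpure b' c') = tpure (b * b') (c * c').
Proof. by rewrite tensor_mul_purel tensor_mull_pure. Qed.

Fact tensor_mulDl : left_distributive tensor_mul +%R.
Proof.
move=> p q r; apply: (@tensor_liftD A (restr phi) (restr psi)) => *;
  [apply: mulg_Dl | apply: mulg_Dr | apply: mulg_Z].
Qed.

Lemma tensor_mul0r q : tensor_mul 0 q = 0.
Proof.
by apply: (@tensor_lift0 A (restr phi) (restr psi)) => *;
  [apply: mulg_Dl | apply: mulg_Dr | apply: mulg_Z].
Qed.

Lemma tensor_mulr0 q : tensor_mul q 0 = 0.
Proof.
by rewrite /tensor_mul /tensor_lift big1 // => x _; apply: tensor_mull0.
Qed.

Lemma tensor_mulDr : right_distributive tensor_mul +%R.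
Proof.
move=> p q r; rewrite -big_split; apply: eq_bigr => x _ /=.
exact: tensor_mullD.
Qed.

Fact tensor_mulC : commutative tensor_mul.
Proof.
move=> p q; elim/tensor_ring_ind: p => [|p p' h h'|b c].
- by rewrite tensor_mul0r tensor_mulr0.
- by rewrite tensor_mulDl tensor_mulDr h h'.
elim/tensor_ring_ind: q => [|q q' h h'|b' c'].
- by rewrite tensor_mul0r tensor_mulr0.
- by rewrite tensor_mulDl tensor_mulDr h h'.
by rewrite !tensor_mul_pure mulrC [c * _]mulrC.
Qed.

Fact tensor_mulA : associative tensor_mul.
Proof.
move=> p q r; elim/tensor_ring_ind: p => [|p p' h h'|b c].
- by rewrite !tensor_mul0r.
- by rewrite !tensor_mulDl h h'.
elim/tensor_ring_ind: q => [|q q' h h'|b' c'].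
- by rewrite tensor_mulr0 !tensor_mul0r tensor_mulr0.
- by rewrite tensor_mulDl !tensor_mulDr h h' tensor_mulDl.
elim/tensor_ring_ind: r => [|r r' h h'|b'' c''].
- by rewrite !tensor_mulr0.
- by rewrite !tensor_mulDr h h'.
by rewrite !tensor_mul_pure !mulrA.
Qed.

Fact tensor_mul1 : left_id (tpure 1 1) tensor_mul.
Proof.
move=> p; elim/tensor_ring_ind: p => [|p p' h h'|b c].
- exact: tensor_mulr0.
- by rewrite tensor_mulDr h h'.
by rewrite tensor_mul_pure !mul1r.
Qed.

HB.instance Definition _ := GRing.Zmodule_isComPzRing.Build tensor_ring
  tensor_mulA tensor_mulC tensor_mul1 tensor_mulDl.

Definition tensor_inl (b : B) : tensor_ring := tpure b 1.
Definition tensor_inr (c : C) : tensor_ring := tpure 1 c.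

Fact tensor_inl_zmod : zmod_morphism tensor_inl.
Proof.
by move=> x y; apply/(addIr (tensor_inl y)); rewrite subrK -tpureDl subrK.
Qed.
HB.instance Definition _ :=
  GRing.isZmodMorphism.Build B tensor_ring tensor_inl tensor_inl_zmod.
Fact tensor_inl_monoid : monoid_morphism tensor_inl.
Proof.
by split=> // x y; rewrite [RHS]tensor_mul_pure mulr1.
Qed.
HB.instance Definition _ :=
  GRing.isMonoidMorphism.Build B tensor_ring tensor_inl tensor_inl_monoid.

Fact tensor_inr_zmod : zmod_morphism tensor_inr.
Proof.
by move=> x y; apply/(addIr (tensor_inr y)); rewrite subrK -tpureDr subrK.
Qed.
HB.instance Definition _ :=
  GRing.isZmodMorphism.Build C tensor_ring tensor_inr tensor_inr_zmod.
Fact tensor_inr_monoid : monoid_morphism tensor_inr.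
Proof.
by split=> // x y; rewrite [RHS]tensor_mul_pure mulr1.
Qed.
HB.instance Definition _ :=
  GRing.isMonoidMorphism.Build C tensor_ring tensor_inr tensor_inr_monoid.

End TensorRing.

(* The power series ring A[[t]]. *)

Section UnivariateSeries.
Variable A : comNzRingType.

Definition fps : Type := nat -> A.
HB.instance Definition _ := gen_eqMixin fps.
HB.instance Definition _ := gen_choiceMixin fps.

Definition fps_const (a : A) : fps := fun i => if i == 0%N then a else 0.
Definition fps_t : fps := fun i => (i == 1%N)%:R.
Definition fps_add (f g : fps) : fps := fun i => f i + g i.
Definition fps_opp (f : fps) : fps := fun i => - f i.
Definition fps_mul (f g : fps) : fps :=
  fun i => \sum_(j < i.+1) f j * g (i - j)%N.

Definition fps_trunc d (f : fps) : {poly A} := \poly_(i < d) f i.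

Lemma fps_truncE d f i : (i < d)%N -> (fps_trunc d f)`_i = f i.
Proof. by move=> h; rewrite coef_poly h. Qed.

Lemma fps_trunc_mul d f g i : (i < d)%N ->
  (fps_trunc d f * fps_trunc d g)`_i = fps_mul f g i.
Proof.
move=> h; rewrite coefM; apply: eq_bigr => j _.
rewrite !fps_truncE ?(leq_ltn_trans (leq_subr _ _)) //.
by rewrite (leq_trans (ltn_ord j)).
Qed.

Fact fps_addA : associative fps_add.
Proof. by move=> f g h; apply/funext => i; apply: addrA. Qed.
Fact fps_addC : commutative fps_add.
Proof. by move=> f g; apply/funext => i; apply: addrC. Qed.
Fact fps_add0 : left_id (fps_const 0) fps_add.
Proof. by move=> f; apply/funext => i; rewrite /fps_add /fps_const if_same add0r. Qed.
Fact fps_addN : left_inverse (fps_const 0) fps_opp fps_add.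
Proof.
by move=> f; apply/funext => i; rewrite /fps_add /fps_const if_same addNr.
Qed.
HB.instance Definition _ := GRing.isZmodule.Build fps
  fps_addA fps_addC fps_add0 fps_addN.

Fact fps_mulA : associative fps_mul.
Proof.
move=> f g h; apply/funext => i; set d := i.+1.
transitivity ((fps_trunc d f * (fps_trunc d g * fps_trunc d h))`_i).
  rewrite coefM; apply: eq_bigr => j _.
  rewrite fps_truncE // fps_trunc_mul //.
  by rewrite ltnS leq_subr.
rewrite mulrA coefM; apply: eq_bigr => j _.
by rewrite fps_trunc_mul // fps_truncE // ltnS leq_subr.
Qed.
Fact fps_mulC : commutative fps_mul.
Proof.
move=> f g; apply/funext => i.
by rewrite -!(@fps_trunc_mul i.+1) // mulrC.
Qed.
Fact fps_mul1 : left_id (fps_const 1) fps_mul.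
Proof.
move=> f; apply/funext => i; rewrite /fps_mul big_ord_recl mul1r subn0.
by rewrite big1 ?addr0 // => j _; rewrite mul0r.
Qed.
Fact fps_mulD : left_distributive fps_mul fps_add.
Proof.
move=> f g h; apply/funext => i; rewrite /fps_mul /fps_add -big_split.
by apply: eq_bigr => j _; rewrite mulrDl.
Qed.
Fact fps_1neq0 : fps_const 1 != fps_const 0.
Proof.
by apply/eqP => /(congr1 (fun f : fps => f 0%N))/eqP; rewrite oner_eq0.
Qed.
HB.instance Definition _ := GRing.Zmodule_isComNzRing.Build fps
  fps_mulA fps_mulC fps_mul1 fps_mulD fps_1neq0.

Fact fps_const_zmod : zmod_morphism fps_const.
Proof.
move=> x y; apply/funext => i.
rewrite [RHS](_ : _ = fps_const x i - fps_const y i) // /fps_const.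
by case: eqP; rewrite ?subrr.
Qed.
HB.instance Definition _ :=
  GRing.isZmodMorphism.Build A fps fps_const fps_const_zmod.
Fact fps_const_monoid : monoid_morphism fps_const.
Proof.
split=> // x y; apply/funext => i; rewrite [RHS]/(fps_mul _ _ _) /fps_mul.
rewrite big_ord_recl /= subn0 big1 ?addr0; last by move=> j _; rewrite mul0r.
by rewrite /fps_const; case: eqP; rewrite ?mulr0.
Qed.
HB.instance Definition _ :=
  GRing.isMonoidMorphism.Build A fps fps_const fps_const_monoid.

End UnivariateSeries.

Section MapSeries.
Variables (A B : comNzRingType) (phi : {rmorphism A -> B}).

Definition fps_map (f : fps A) : fps B := fun i => phi (f i).

Fact fps_map_zmod : zmod_morphism fps_map.
Proof. by move=> f g; apply/funext => i; apply: rmorphB. Qed.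
HB.instance Definition _ :=
  GRing.isZmodMorphism.Build (fps A) (fps B) fps_map fps_map_zmod.
Fact fps_map_monoid : monoid_morphism fps_map.
Proof.
split=> [|f g]; apply/funext => i.
  by rewrite /fps_map [LHS](fun_if phi) rmorph1 rmorph0.
by rewrite /fps_map [LHS]rmorph_sum; apply: eq_bigr => j _; apply: rmorphM.
Qed.
HB.instance Definition _ :=
  GRing.isMonoidMorphism.Build (fps A) (fps B) fps_map fps_map_monoid.

End MapSeries.

(* The power series ring A[[x_1, ..., x_n]]. *)

Fact mdeg_addl n (m k l : 'X_{1..n}) : m = (k + l)%MM -> (mdeg k <= mdeg m)%N.
Proof. by move=> ->; rewrite mdegD leq_addr. Qed.

Fact mdeg_addr n (m k l : 'X_{1..n}) : m = (k + l)%MM -> (mdeg l <= mdeg m)%N.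
Proof. by move=> ->; rewrite mdegD leq_addl. Qed.

Section MultivariateSeries.
Variables (n : nat) (A : comNzRingType).

Definition mps : Type := 'X_{1..n} -> A.
HB.instance Definition _ := gen_eqMixin mps.
HB.instance Definition _ := gen_choiceMixin mps.

Definition mps_const (a : A) : mps := fun m => if m == 0%MM then a else 0.
Definition mps_var (i : 'I_n) : mps := fun m => (m == U_(i)%MM)%:R.
Definition mps_add (f g : mps) : mps := fun m => f m + g m.
Definition mps_opp (f : mps) : mps := fun m => - f m.
(* the bounds only serve to make the sum over m = k1 + k2 finite *)
Definition mps_mul (f g : mps) : mps := fun m =>
  \sum_(k : 'X_{1..n < (mdeg m).+1, (mdeg m).+1} | m == (k.1 + k.2)%MM)
    f k.1 * g k.2.

Definition mps_trunc d (f : mps) : {mpoly A[n]} :=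
  \sum_(m : 'X_{1..n < d}) f m *: 'X_[m].

Lemma mps_truncE d f m : (mdeg m < d)%N -> (mps_trunc d f)@_m = f m.
Proof.
move=> h; rewrite /mps_trunc raddf_sum (bigD1 (BMultinom h)) //=.
rewrite mcoeffZ mcoeffX eqxx mulr1 big1 ?addr0 // => k hk.
rewrite mcoeffZ mcoeffX; case: eqP; last by rewrite mulr0.
by move=> e; case/eqP: hk; apply: val_inj.
Qed.

Lemma mps_trunc_mul d f g m : (mdeg m < d)%N ->
  (mps_trunc d f * mps_trunc d g)@_m = mps_mul f g m.
Proof.
move=> h; rewrite mcoeffM; apply: eq_bigr => k /eqP e.
by rewrite !mps_truncE //; apply: leq_ltn_trans h;
  [exact: mdeg_addr e | exact: mdeg_addl e].
Qed.

Fact mps_addA : associative mps_add.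
Proof. by move=> f g h; apply/funext => i; apply: addrA. Qed.
Fact mps_addC : commutative mps_add.
Proof. by move=> f g; apply/funext => i; apply: addrC. Qed.
Fact mps_add0 : left_id (mps_const 0) mps_add.
Proof. by move=> f; apply/funext => i; rewrite /mps_add /mps_const if_same add0r. Qed.
Fact mps_addN : left_inverse (mps_const 0) mps_opp mps_add.
Proof.
by move=> f; apply/funext => i; rewrite /mps_add /mps_const if_same addNr.
Qed.
HB.instance Definition _ := GRing.isZmodule.Build mps
  mps_addA mps_addC mps_add0 mps_addN.

Fact mps_mulA : associative mps_mul.
Proof.
move=> f g h; apply/funext => m; set d := (mdeg m).+1.
transitivity ((mps_trunc d f * (mps_trunc d g * mps_trunc d h))@_m).
  rewrite mcoeffM; apply: eq_bigr => k /eqP e.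
  by rewrite mps_truncE ?mps_trunc_mul // ltnS ?(mdeg_addl e) ?(mdeg_addr e).
rewrite mulrA mcoeffM; apply: eq_bigr => k /eqP e.
by rewrite mps_truncE ?mps_trunc_mul // ltnS ?(mdeg_addl e) ?(mdeg_addr e).
Qed.
Fact mps_mulC : commutative mps_mul.
Proof.
move=> f g; apply/funext => m.
by rewrite -!(@mps_trunc_mul (mdeg m).+1) // mulrC.
Qed.

Lemma mps_trunc_const d a : (0 < d)%N -> mps_trunc d (mps_const a) = a%:MP_[n].
Proof.
move=> h; apply/mpolyP => m; rewrite mcoeffC.
have [hm|hm] := ltnP (mdeg m) d.
  by rewrite mps_truncE // /mps_const; case: eqP; rewrite ?mulr1 ?mulr0.
rewrite /mps_trunc raddf_sum big1 => [|k _] /=.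
  case: eqP => [e|]; last by rewrite mulr0.
  by move: hm; rewrite e mdeg0 leqNgt h.
rewrite mcoeffZ mcoeffX; case: eqP => [e|]; last by rewrite mulr0.
by move: hm (bmdeg k); rewrite -e leqNgt => /negP.
Qed.

Lemma mps_mul_const a f m : mps_mul (mps_const a) f m = a * f m.
Proof.
rewrite -(@mps_trunc_mul (mdeg m).+1) // mps_trunc_const //.
by rewrite mcoeffCM mps_truncE.
Qed.

Fact mps_mul1 : left_id (mps_const 1) mps_mul.
Proof. by move=> f; apply/funext => m; rewrite mps_mul_const mul1r. Qed.
Fact mps_mulD : left_distributive mps_mul mps_add.
Proof.
move=> f g h; apply/funext => m; rewrite /mps_mul /mps_add -big_split.
by apply: eq_bigr => k _; rewrite mulrDl.
Qed.
Fact mps_1neq0 : mps_const 1 != mps_const 0.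
Proof.
apply/eqP => /(congr1 (fun f : mps => f 0%MM))/eqP.
by rewrite /mps_const eqxx oner_eq0.
Qed.
HB.instance Definition _ := GRing.Zmodule_isComNzRing.Build mps
  mps_mulA mps_mulC mps_mul1 mps_mulD mps_1neq0.

Fact mps_const_zmod : zmod_morphism mps_const.
Proof.
move=> x y; apply/funext => m.
rewrite [RHS](_ : _ = mps_const x m - mps_const y m) // /mps_const.
by case: eqP; rewrite ?subrr.
Qed.
HB.instance Definition _ :=
  GRing.isZmodMorphism.Build A mps mps_const mps_const_zmod.
Fact mps_const_monoid : monoid_morphism mps_const.
Proof.
split=> // x y; apply/funext => m; rewrite [RHS]mps_mul_const /mps_const.
by case: eqP; rewrite ?mulr0.
Qed.
HB.instance Definition _ :=
  GRing.isMonoidMorphism.Build A mps mps_const mps_const_monoid.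

Definition mps_ideal : ideal mps := ideal_gen (fun f => exists i, f = mps_var i).

Definition hcomp (i : nat) (f : mps) : mps :=
  fun m => if mdeg m == i then f m else 0.

(* o(f), the least i with f_i <> 0 (junk value 0 for f = 0) *)
Definition series_order (f : mps) : nat :=
  if pselect (exists i, hcomp i f != 0) is left h then ex_minn h else 0%N.

(* hom(f) = \sum_(i >= o(f)) t^(i - o(f)) f_i, as an element of S[[t]] *)
Definition homogenize (f : mps) : fps mps := fun j => hcomp (series_order f + j) f.

Definition hom_ideal (I : ideal mps) : ideal (fps mps) :=
  ideal_gen (fun g => exists f, f != 0 /\ I f /\ g = homogenize f).

End MultivariateSeries.

(* The associated graded ring of A with respect to J.  A finite sum
   \sum_i a_i X^i with a_i in J^i represents the element of
   \bigoplus_i J^i / J^(i+1) whose component of degree i is the class of a_i;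
   polynomials with a_i in J^(i+1) for all i represent 0. *)

Section AssociatedGraded.
Variables (A : comNzRingType) (J : ideal A).

Definition filtered : {pred {poly A}} :=
  fun p => `[< forall i, ideal_pow J i p`_i >].

Fact filtered_subring : subring_closed filtered.
Proof.
split.
- apply/asboolP => -[|i] //; rewrite coef1; exact: ideal_0.
- move=> p q /asboolP hp /asboolP hq; apply/asboolP => i.
  by rewrite coefB; apply: ideal_B.
- move=> p q /asboolP hp /asboolP hq; apply/asboolP => i; rewrite coefM.
  apply: big_ind => [|x y|j _]; [exact: ideal_0 | exact: ideal_D |].
  by rewrite -[X in ideal_pow J X](subnKC (leq_ord j)); apply: ideal_pow_mul.
Qed.

Record filtered_poly := FilteredPoly {
  fp_val :> {poly A};
  fp_valP : fp_val \in filtered }.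

HB.instance Definition _ := [isSub for fp_val].
HB.instance Definition _ := [Choice of filtered_poly by <:].
HB.instance Definition _ :=
  GRing.SubChoice_isSubComNzRing.Build _ _ filtered_poly filtered_subring.

Lemma fpP (p : filtered_poly) i : ideal_pow J i (val p)`_i.
Proof. by move/asboolP: (fp_valP p). Qed.

Definition gr_zero : ideal filtered_poly.
Proof.
refine (@Ideal filtered_poly
  (fun p => forall i, ideal_pow J i.+1 (val p)`_i) _ _ _).
- by move=> i; rewrite rmorph0 coef0; apply: ideal_0.
- by move=> p q hp hq i; rewrite rmorphD coefD; apply: ideal_D.
- move=> a p hp i; rewrite rmorphM coefM.
  apply: big_ind => [|x y|j _]; [exact: ideal_0 | exact: ideal_D |].
  rewrite -[X in ideal_pow J X.+1](subnKC (leq_ord j)) -addnS.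
  by apply: ideal_pow_mul; [apply: fpP | apply: hp].
Defined.

Definition gr : comPzRingType := quotient gr_zero.

(* \bigoplus_(i > 0) J^i / J^(i+1) *)
Definition gr_plus : ideal gr.
Proof.
refine (@Ideal gr (fun g => exists p : filtered_poly,
  (val p)`_0 = 0 /\ g = proj gr_zero p) _ _ _).
- by exists 0; rewrite !rmorph0 coef0.
- move=> _ _ [p [hp ->]] [q [hq ->]]; exists (p + q).
  by rewrite !rmorphD coefD hp hq addr0.
- move=> a _ [p [hp ->]]; have [b <-] := proj_surj a; exists (b * p).
  by rewrite !rmorphM coef0M hp mulr0.
Defined.

Fact filtered_const (a : A) : a%:P \in filtered.
Proof.
by apply/asboolP => -[|i] //; rewrite coefC; apply: ideal_0.
Qed.

Definition fp_const (a : A) : filtered_poly := FilteredPoly (filtered_const a).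

Fact fp_const_zmod : zmod_morphism fp_const.
Proof. by move=> x y; apply: val_inj; rewrite rmorphB /= polyCB. Qed.
HB.instance Definition _ :=
  GRing.isZmodMorphism.Build A filtered_poly fp_const fp_const_zmod.
Fact fp_const_monoid : monoid_morphism fp_const.
Proof.
by split=> [|x y]; apply: val_inj; rewrite ?rmorph1 // rmorphM /= polyCM.
Qed.
HB.instance Definition _ :=
  GRing.isMonoidMorphism.Build A filtered_poly fp_const fp_const_monoid.

End AssociatedGraded.

Definition noetherian (A : comPzRingType) : Prop :=
  forall I : ideal A, exists s : seq A, forall x,
    I x <-> ideal_gen (fun y => y \in s) x.

Definition maximal_ideal (A : comPzRingType) (I : ideal A) : Prop :=
  ~ I 1 /\ forall J : ideal A, (forall x, I x -> J x) ->
    (forall x, J x -> I x) \/ J 1.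

Definition local_ring (A : comPzRingType) (m : ideal A) : Prop :=
  maximal_ideal m /\ forall J : ideal A, maximal_ideal J -> forall x, J x <-> m x.

Definition adically_complete (A : comPzRingType) (J : ideal A) : Prop :=
  bijective (to_completion J).

Definition coefficient_field (k : fieldType) (A : comPzRingType) (m : ideal A)
    (iota : {rmorphism k -> A}) : Prop :=
  bijective (proj m \o iota).

(* dim_k (m / m^2) = n: there are n elements of m whose classes form a basis *)
Definition cotangent_dim (k : fieldType) (A : comPzRingType) (m : ideal A)
    (iota : {rmorphism k -> A}) (n : nat) : Prop :=
  exists b : 'I_n -> A,
    [/\ forall i, m (b i),
        forall y, m y -> exists c : 'I_n -> k,
          ideal_pow m 2 (y - \sum_i iota (c i) * b i)
      & forall c : 'I_n -> k,
          ideal_pow m 2 (\sum_i iota (c i) * b i) -> forall i, c i = 0].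

Definition alg_iso (A B C : comPzRingType)
    (phi : {rmorphism A -> B}) (psi : {rmorphism A -> C}) : Prop :=
  exists f : {rmorphism B -> C}, bijective f /\ forall a, f (phi a) = psi a.

Section HomogenizedRing.
Variables (k : fieldType) (n : nat) (I : ideal (mps n k)).

Definition homR : comPzRingType := quotient (hom_ideal I).

Definition homR_proj : {rmorphism fps (mps n k) -> homR} := proj (hom_ideal I).

Definition homR_str : {rmorphism fps k -> homR} :=
  homR_proj \o fps_map (@mps_const n k).

Definition homR_S : {rmorphism mps n k -> homR} :=
  homR_proj \o @fps_const (mps n k).

Definition homR_t : ideal homR :=
  ideal_gen (fun x => x = homR_str (fps_t k)).

Definition special_str : {rmorphism k -> quotient homR_t} :=
  proj homR_t \o homR_str \o @fps_const k.

(* k((t)) = k[[t]][1/t] *)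
Definition laurent : comPzRingType := loc (fps_t k).

Definition fps_laurent : {rmorphism fps k -> laurent} := to_loc (fps_t k).
Definition const_laurent : {rmorphism k -> laurent} :=
  fps_laurent \o @fps_const k.

Definition homR_generic : comPzRingType := tensor_ring homR_str fps_laurent.

Definition homR_generic_x : ideal homR_generic :=
  ideal_ext (@tensor_inl _ _ _ homR_str fps_laurent \o homR_S) (mps_ideal n k).

Definition homR_generic_str :
    {rmorphism laurent -> completion homR_generic_x} :=
  to_completion homR_generic_x \o @tensor_inr _ _ _ homR_str fps_laurent.

Section Generic.
Variables (R : comNzRingType) (iota : {rmorphism k -> R}).
Variable phi : {rmorphism quotient I -> R}.

Definition R_generic : comPzRingType := tensor_ring iota const_laurent.

Definition R_generic_x : ideal R_generic :=
  ideal_ext (@tensor_inl _ _ _ iota const_laurent \o phi \o proj I)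
    (mps_ideal n k).

Definition R_generic_str : {rmorphism laurent -> completion R_generic_x} :=
  to_completion R_generic_x \o @tensor_inr _ _ _ iota const_laurent.

End Generic.

Section Graded.
Variables (R : comNzRingType) (m : ideal R) (iota : {rmorphism k -> R}).

Definition gr_completion_str : {rmorphism k -> completion (gr_plus m)} :=
  to_completion (gr_plus m) \o (proj (gr_zero m) : {rmorphism _ -> gr m})
    \o @fp_const R m \o iota.

End Graded.
End HomogenizedRing.

(* Main.v *)
Require Import Defs.
From HB Require Import structures.
From mathcomp Require Import all_boot all_order all_algebra.
From mathcomp Require Import boolp.
From mathcomp Require Import mpoly.
From mathcomp Require Import zify.

Set Implicit Arguments.
Unset Strict Implicit.
Unset Printing Implicit Defensive.

Import Order.TTheory GRing.Theory.
Local Open Scope ring_scope.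

(** Write S = k[[x]], T = S[[t]], and psi : S -> R for the surjection with
    kernel I.  Give every variable x_i weight 1 and t weight -1.  Then hom(f)
    is homogeneous of weight o(f), and setting t = 1 turns it back into f.
    Every g in T is the sum of its weight components, and the proof rests on
    the criterion [hom_idealP]: g lies in hom(I) if and only if all these
    components dehomogenize into I.  The direct implication is formal.  For
    the converse one has to write g with finitely many generators hom(F_i)
    although g has infinitely many components.  This is done with a standard
    basis of I ([standard_basis], from Dickson's lemma and division of power
    series): each dehomogenized component is a combination of the F_i whose
    coefficients have the largest order that the component allows, so these
    coefficients homogenize to elements of T, one in each weight, and can be
    summed.

    Flatness.  Multiplication by t only shifts the weights, so the criterion
    shows that t g in hom(I) implies g in hom(I).  A k[[t]]-module without
    t-torsion is flat, because its finitely generated submodules are free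
    ([flat_of_torsion_free]).

    Special fibre.  The ideal (x_1, ..., x_n) maps onto m, as R has only one
    maximal ideal.  Hence f |-> sum of psi(f_i) in m^i / m^(i+1) is a
    surjection of S onto the completion of gr(R).  Its kernel consists of
    the series all of whose homogeneous components are initial forms of I, and
    by the criterion these are exactly the constant terms in t of hom(I)
    ([initial_series_kernel]).

    Generic fibre.  The substitution x |-> tx maps f to t^o(f) hom(f), hence
    sends I into hom(I).  Once t is invertible and powers of (x_1, ..., x_n)
    are killed, x |-> x/t makes sense as well and is the inverse, so the two
    rings have the same quotients by the powers of (x_1, ..., x_n)
    ([dilate_contract], [contract_dilate]) and therefore the same completion
    ([completion_map_bij]). *)

(** * Quotients, ideals and their powers *)

Section QuotientLift.
Variables (A B : comPzRingType) (I : ideal A) (F : {rmorphism A -> B}).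

(** The vanishing of F on I is an argument of the function so that the ring
    morphism structure can be attached to the applied term. *)
Definition quotient_lift of (forall x, I x -> F x = 0) :=
  fun q : quotient I => F (rep q) : B.

Hypothesis F0 : forall x, I x -> F x = 0.
Let lift := quotient_lift F0.

Lemma quotient_liftE x : quotient_lift F0 (proj I x) = F x.
Proof.
apply/subr0_eq; rewrite -rmorphB; apply: F0.
exact: (rep_cls (ideal_eqv I)).
Qed.

Fact quotient_lift_zmod : zmod_morphism lift.
Proof.
move=> p q; have [x <-] := proj_surj p; have [y <-] := proj_surj q.
by rewrite -rmorphB /lift !quotient_liftE rmorphB.
Qed.
HB.instance Definition _ :=
  GRing.isZmodMorphism.Build (quotient I) B lift quotient_lift_zmod.
Fact quotient_lift_monoid : monoid_morphism lift.
Proof.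
split=> [|p q]; first by rewrite -(rmorph1 (proj I)) /lift quotient_liftE rmorph1.
have [x <-] := proj_surj p; have [y <-] := proj_surj q.
by rewrite -rmorphM /lift !quotient_liftE rmorphM.
Qed.
HB.instance Definition _ :=
  GRing.isMonoidMorphism.Build (quotient I) B lift quotient_lift_monoid.

End QuotientLift.

Lemma proj0 (A : comPzRingType) (I : ideal A) x : proj I x = 0 <-> I x.
Proof. by rewrite -(rmorph0 (proj I)) proj_eq subr0. Qed.

Section InverseMorphism.
Variables (B C : comPzRingType) (f : {rmorphism B -> C}) (g : C -> B).
Hypotheses (fK : cancel f g) (gK : cancel g f).

(** The cancellation proofs are arguments for the same reason as in
    [quotient_lift]. *)
Definition inverse_of of cancel f g & cancel g f := g.
Let h := inverse_of fK gK.

Fact inverse_zmod : zmod_morphism h.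
Proof. exact: can2_zmod_morphism fK gK. Qed.
HB.instance Definition _ := GRing.isZmodMorphism.Build C B h inverse_zmod.
Fact inverse_monoid : monoid_morphism h.
Proof. exact: can2_monoid_morphism fK gK. Qed.
HB.instance Definition _ := GRing.isMonoidMorphism.Build C B h inverse_monoid.

Definition inverse_morphism : {rmorphism C -> B} := h.

End InverseMorphism.

Lemma alg_iso_sym (A B C : comPzRingType)
    (phi : {rmorphism A -> B}) (psi : {rmorphism A -> C}) :
  alg_iso phi psi -> alg_iso psi phi.
Proof.
move=> [f [[g fK gK] fE]]; exists (inverse_morphism fK gK).
split=> [|a]; first by exists f.
by rewrite -fE; apply: fK.
Qed.

Section Ideals.
Variable A : comPzRingType.

Lemma ideal_gen_sub (P : A -> Prop) (J : ideal A) :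
  (forall x, P x -> J x) -> forall x, ideal_gen P x -> J x.
Proof.
move=> h x; elim=> {x} [x|||]; [exact: h|exact: ideal_0| |].
  by move=> x y _ hx _ hy; apply: ideal_D.
by move=> a x _ hx; apply: ideal_M.
Qed.

Lemma ideal_sum (J : ideal A) (T : Type) (r : seq T) (P : pred T) (F : T -> A) :
  (forall i, P i -> J (F i)) -> J (\sum_(i <- r | P i) F i).
Proof.
by move=> h; apply: big_ind => //; [apply: ideal_0 | apply: ideal_D].
Qed.

Lemma ideal_pow_le (J : ideal A) i j x :
  (i <= j)%N -> ideal_pow J j x -> ideal_pow J i x.
Proof.
move=> /subnK <-; elim: (j - i)%N => [|d IH] //.
by rewrite addSn => /ideal_powS.
Qed.

End Ideals.

Section IdealMorphism.
Variables (A B : comPzRingType) (F : {rmorphism A -> B}).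

Definition preimage_ideal (J : ideal B) : ideal A.
Proof.
refine (@Ideal A (fun x => J (F x)) _ _ _).
- by rewrite rmorph0; apply: ideal_0.
- by move=> x y hx hy; rewrite rmorphD; apply: ideal_D.
- by move=> a x hx; rewrite rmorphM; apply: ideal_M.
Defined.

Lemma ideal_pow_morph (I : ideal A) (J : ideal B) :
  (forall x, I x -> J (F x)) ->
  forall j x, ideal_pow I j x -> ideal_pow J j (F x).
Proof.
move=> h; elim=> [|j IH] x //=.
apply: (ideal_gen_sub (J := preimage_ideal (ideal_pow J j.+1))) => _ [a [b [ha [hb ->]]]].
by rewrite /= rmorphM; apply: ideal_span_in; exists (F a), (F b); split; auto.
Qed.

Hypothesis F_surj : forall y, exists x, F x = y.

Definition image_ideal (I : ideal A) : ideal B.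
Proof.
refine (@Ideal B (fun y => exists x, I x /\ y = F x) _ _ _).
- by exists 0; rewrite rmorph0; split=> //; apply: ideal_0.
- move=> _ _ [x [hx ->]] [y [hy ->]]; exists (x + y).
  by rewrite rmorphD; split=> //; apply: ideal_D.
- move=> b _ [x [hx ->]]; have [a <-] := F_surj b; exists (a * x).
  by rewrite rmorphM; split=> //; apply: ideal_M.
Defined.

Lemma image_ideal_pow (I : ideal A) j y :
  ideal_pow (image_ideal I) j y -> exists x, ideal_pow I j x /\ y = F x.
Proof.
elim: j y => [|j IH] y /=; first by move=> _; have [x <-] := F_surj y; exists x.
move=> hy; apply: (ideal_gen_sub (J := image_ideal (ideal_pow I j.+1)) _ hy).
move=> {hy} _ [_ [b [[a [ha ->]] [hb ->]]]].
have [c [hc ->]] := IH _ hb; exists (a * c); rewrite rmorphM; split=> //.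
by apply: ideal_span_in; exists a, c.
Qed.

End IdealMorphism.

(** * Completions *)

Lemma completion_eq (A : comPzRingType) (J : ideal A) (u v : completion J) :
  (forall j, completion_val u j = completion_val v j) -> u = v.
Proof. by move=> h; apply: val_inj; apply: functional_extensionality_dep. Qed.

Lemma completion_compat (A : comPzRingType) (J : ideal A) (u : completion J) i j x :
  (i <= j)%N -> completion_val u j = proj _ x -> completion_val u i = proj _ x.
Proof.
have /asboolP hu := completionP u.
move=> /subnK <-; elim: (j - i)%N x => [|d IH] x //.
rewrite addSn => h; apply: IH; rewrite -hu h; exact: transitionE.
Qed.

(** A compatible family of morphisms to the quotients by the powers of J is a
    morphism to their inverse limit. *)
Section CompletionMorphism.
Variables (C A : comPzRingType) (J : ideal A) (F : forall j, {rmorphism C -> quotient (ideal_pow J j)}).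
Hypothesis F_compat : forall j x, transition (F j.+1 x) = F j x.

Fact completion_lift_compat x :
  ((fun j => F j x) : prod_ring (fun j => quotient (ideal_pow J j))) \in @compatible A J.
Proof. by apply/asboolP. Qed.

Definition completion_lift (x : C) : completion J :=
  Completion (completion_lift_compat x).

Fact completion_lift_zmod : zmod_morphism completion_lift.
Proof. by move=> x y; apply: completion_eq => j; apply: (rmorphB (F j)). Qed.
HB.instance Definition _ := GRing.isZmodMorphism.Build C (completion J)
  completion_lift completion_lift_zmod.
Fact completion_lift_monoid : monoid_morphism completion_lift.
Proof.
split=> [|x y]; apply: completion_eq => j; first exact: (rmorph1 (F j)).
exact: (rmorphM (F j)).
Qed.
HB.instance Definition _ := GRing.isMonoidMorphism.Build C (completion J)
  completion_lift completion_lift_monoid.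

End CompletionMorphism.

Section CompletionMap.
Variables (B A : comPzRingType) (I : ideal B) (J : ideal A) (f : {rmorphism B -> A}).
Hypothesis f_sub : forall x, I x -> J (f x).

Fact completion_level_kernel j x : ideal_pow I j x ->
  (proj (ideal_pow J j) \o f) x = 0.
Proof. by move=> h; apply/proj0; apply: ideal_pow_morph h. Qed.

Definition completion_level j :
    {rmorphism quotient (ideal_pow I j) -> quotient (ideal_pow J j)} :=
  quotient_lift (@completion_level_kernel j).

Lemma completion_levelE j x :
  completion_level j (proj (ideal_pow I j) x) = proj (ideal_pow J j) (f x).
Proof. exact: quotient_liftE. Qed.

Definition completion_at j (u : completion I) : quotient (ideal_pow I j) :=
  completion_val u j.
Fact completion_at_zmod j : zmod_morphism (completion_at j).
Proof. by []. Qed.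
HB.instance Definition _ j := GRing.isZmodMorphism.Build _ _
  (completion_at j) (@completion_at_zmod j).
Fact completion_at_monoid j : monoid_morphism (completion_at j).
Proof. by []. Qed.
HB.instance Definition _ j := GRing.isMonoidMorphism.Build _ _
  (completion_at j) (@completion_at_monoid j).

Fact completion_map_compat j (u : completion I) :
  transition ((completion_level j.+1 \o completion_at j.+1) u) =
  (completion_level j \o completion_at j) u.
Proof.
have [x e] := proj_surj (completion_val u j.+1).
change (transition (completion_level j.+1 (completion_val u j.+1)) =
  completion_level j (completion_val u j)).
rewrite -e (completion_compat (leqnSn j) (esym e)).
by rewrite !completion_levelE transitionE.
Qed.

Definition completion_map : {rmorphism completion I -> completion J} :=
  completion_lift completion_map_compat.

Hypothesis f_inj : forall j x, ideal_pow J j (f x) -> ideal_pow I j x.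
Hypothesis f_surj : forall j y, exists x, ideal_pow J j (y - f x).

(** A completion only depends on the quotients by the powers of the ideal, so
    f may be neither injective nor surjective itself. *)
Lemma completion_map_bij : bijective completion_map.
Proof.
have inj j : injective (completion_level j).
  apply: raddf_inj => p; have [x <-] := proj_surj p.
  move=> h; apply/proj0/f_inj/proj0; rewrite -h.
  exact/esym/completion_levelE.
have surj (v : completion J) j :
    exists p, completion_level j p = completion_val v j.
  have [y <-] := proj_surj (completion_val v j).
  have [x h] := f_surj j y; exists (proj _ x); rewrite completion_levelE.
  by apply/esym/proj_eq.
pose g v j := projT1 (cid (surj v j)).
have gE v j : completion_level j (g v j) = completion_val v j.
  exact: projT2 (cid (surj v j)).
have gC v : (g v : prod_ring (fun j => quotient (ideal_pow I j))) \in @compatible B I.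
  apply/asboolP => j; apply: inj; rewrite gE.
  have [x e] := proj_surj (g v j.+1); rewrite -e transitionE completion_levelE.
  apply/esym/(completion_compat (leqnSn j)).
  by rewrite -gE -e completion_levelE.
exists (fun v => Completion (gC v)) => [u|v]; apply: completion_eq => j.
  by apply: inj; rewrite gE.
exact: gE.
Qed.

End CompletionMap.

(** * Tensor products of rings *)

(** The universal property of the tensor product of rings: existence here,
    uniqueness in [tensor_ring_eq]. *)
Section TensorRingLift.
Variables (A B C Z : comPzRingType).
Variables (phi : {rmorphism A -> B}) (psi : {rmorphism A -> C}).
Variables (u : {rmorphism B -> Z}) (v : {rmorphism C -> Z}).

Definition tensor_ring_lift of (forall a, u (phi a) = v (psi a)) :
    tensor_ring phi psi -> Z :=
  @tensor_lift A (restr phi) (restr psi) Z (fun (b : B) (c : C) => u b * v c).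

Hypothesis uv : forall a, u (phi a) = v (psi a).
Let lift := tensor_ring_lift uv.

Let lDl (b b' : B) (c : C) : u (b + b') * v c = u b * v c + u b' * v c.
Proof. by rewrite rmorphD mulrDl. Qed.
Let lDr (b : B) (c c' : C) : u b * v (c + c') = u b * v c + u b * v c'.
Proof. by rewrite rmorphD mulrDr. Qed.
Let lZ (a : A) (b : B) (c : C) : u (phi a * b) * v c = u b * v (psi a * c).
Proof. by rewrite !rmorphM uv mulrCA mulrA. Qed.

Lemma tensor_ring_liftE b c : tensor_ring_lift uv (tpure phi psi b c) = u b * v c.
Proof.
exact: (@tensor_liftE A (restr phi) (restr psi) Z _ lDl lDr lZ).
Qed.

Lemma tensor_ring_liftD p q :
  lift (p + q) = lift p + lift q.
Proof.
exact: (@tensor_liftD A (restr phi) (restr psi) Z _ lDl lDr lZ).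
Qed.

Fact tensor_ring_lift_zmod : zmod_morphism lift.
Proof.
move=> p q; apply: (addIr (lift q)).
by rewrite -tensor_ring_liftD !subrK.
Qed.
HB.instance Definition _ := GRing.isZmodMorphism.Build
  (tensor_ring phi psi) Z lift tensor_ring_lift_zmod.
Fact tensor_ring_lift_monoid : monoid_morphism lift.
Proof.
split=> [|p q]; first by rewrite /lift tensor_ring_liftE !rmorph1 mulr1.
elim/tensor_ring_ind: p => [|p p' h h'|b c].
- by rewrite mul0r raddf0 mul0r.
- by rewrite mulrDl !tensor_ring_liftD h h' mulrDl.
elim/tensor_ring_ind: q => [|q q' h h'|b' c'].
- by rewrite mulr0 raddf0 mulr0.
- by rewrite mulrDr !tensor_ring_liftD h h' mulrDr.
rewrite [X in lift X](tensor_mul_pure phi psi).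
by rewrite /lift !tensor_ring_liftE !rmorphM mulrACA.
Qed.
HB.instance Definition _ := GRing.isMonoidMorphism.Build
  (tensor_ring phi psi) Z lift tensor_ring_lift_monoid.

End TensorRingLift.

Lemma tpureM (A B C : comPzRingType) (phi : {rmorphism A -> B})
    (psi : {rmorphism A -> C}) b c :
  tpure phi psi b c = tensor_inl phi psi b * tensor_inr phi psi c.
Proof.
by rewrite [RHS](tensor_mul_pure phi psi) mulr1 mul1r.
Qed.

Lemma tensor_ring_eq (A B C Z : comPzRingType) (phi : {rmorphism A -> B})
    (psi : {rmorphism A -> C}) (F G : {rmorphism tensor_ring phi psi -> Z}) :
  (forall b, F (tensor_inl phi psi b) = G (tensor_inl phi psi b)) ->
  (forall c, F (tensor_inr phi psi c) = G (tensor_inr phi psi c)) ->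
  forall p, F p = G p.
Proof.
move=> hl hr; elim/tensor_ring_ind => [|p q h h'|b c].
- by rewrite !raddf0.
- by rewrite !rmorphD h h'.
by rewrite tpureM !rmorphM hl hr.
Qed.

Lemma tensor_ring_inlr (A B C : comPzRingType) (phi : {rmorphism A -> B})
    (psi : {rmorphism A -> C}) a :
  tensor_inl phi psi (phi a) = tensor_inr phi psi (psi a).
Proof.
rewrite /tensor_inl /tensor_inr -[phi a]mulr1 tpureZ mulr1.
by [].
Qed.

(** * Triangular systems and power series in one variable *)

(** A system in which the equation for m determines c m from the values at
    smaller indices is solved by well-founded recursion.  This yields both the
    inverse of a power series and the quotients of a division. *)
Lemma triangular_surj (M : Type) (lt : M -> M -> Prop) (V : zmodType)
    (Phi : (M -> V) -> M -> V) : well_founded lt ->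
  (forall c c' m, (forall m', lt m' m -> c m' = c' m') ->
     Phi c m - c m = Phi c' m - c' m) ->
  forall f, exists c, forall m, Phi c m = f m.
Proof.
move=> wf loc f.
pose below m (g : forall m', lt m' m -> V) m' : V :=
  if pselect (lt m' m) is left h then g m' h else 0.
pose step m (g : forall m', lt m' m -> V) : V :=
  f m - (Phi (below m g) m - below m g m).
pose c := Fix wf (fun=> V) step.
have cE m : c m = f m - (Phi c m - c m).
  rewrite {1}/c Fix_eq => [|x g g' e].
    congr (_ - _); apply: loc => m' h; rewrite /below.
    by case: pselect.
  congr (step x _); apply: functional_extensionality_dep => y.
  exact: functional_extensionality_dep.
exists c => m; move: (cE m) => /(congr1 (fun x => x + (Phi c m - c m))).
by rewrite subrK addrCA subrr addr0.
Qed.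

Section SeriesInT.
Variable A : comNzRingType.
Implicit Types f g : fps A.

Lemma fpsM f g i : (f * g) i = \sum_(j < i.+1) f j * g (i - j)%N.
Proof. by []. Qed.

Lemma fpsD f g i : (f + g) i = f i + g i. Proof. by []. Qed.
Lemma fpsB f g i : (f - g) i = f i - g i. Proof. by []. Qed.
Lemma fps0 i : (0 : fps A) i = 0. Proof. by rewrite /GRing.zero /= /fps_const if_same. Qed.
Lemma fps1 i : (1 : fps A) i = (i == 0%N)%:R.
Proof. by rewrite /GRing.one /= /fps_const; case: eqP. Qed.

Lemma fps_tM f i : (fps_t A * f) i = if i is j.+1 then f j else 0.
Proof.
rewrite fpsM big_ord_recl /= mul0r add0r.
case: i => [|i]; first by rewrite big_ord0.
rewrite big_ord_recl /= mul1r subSS subn0 big1 ?addr0 // => j _.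
by rewrite /fps_t /= mul0r.
Qed.

Lemma fps_tnM v f i :
  (fps_t A ^+ v * f) i = if (v <= i)%N then f (i - v)%N else 0.
Proof.
elim: v i => [|v IH] i; first by rewrite expr0 mul1r subn0.
by rewrite exprS -mulrA fps_tM; case: i => [|i] //; rewrite IH subSS.
Qed.

End SeriesInT.

Lemma fps_inv (k : fieldType) (u : fps k) : u 0%N != 0 -> exists w, w * u = 1.
Proof.
move=> u0.
have lead (w : fps k) i : (u * w) i =
    u 0%N * w i + \sum_(j < i) u j.+1 * w (i - j.+1)%N.
  by rewrite fpsM big_ord_recl subn0.
have [||w hw] := @triangular_surj nat (fun i j => (i < j)%N) k
    (fun w i => (u 0%N)^-1 * (u * (w : fps k)) i) _ _
    (fun i => (u 0%N)^-1 * (1 : fps k) i).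
- by elim/ltn_ind => i IH; constructor.
- move=> c c' i h; rewrite !lead !mulrDr !mulKf // !(addrC (c _)) !(addrC (c' _)) !addrK.
  congr (_ * _); apply: eq_bigr => j _; rewrite h //.
  by rewrite ltn_subrL; case: (i) j => [[]|].
exists (w : fps k); apply/funext => i; rewrite mulrC.
exact/(mulfI (invr_neq0 u0))/hw.
Qed.

(** * Flatness over k[[t]] *)

(** A derivation of an equality of tensors mentions finitely many elements e of
    the second factor.  Only the linearity of lam on these is used along it,
    so lam need not be defined as a linear map on the whole module. *)
Lemma tensor_rel_functional (A : comPzRingType) (M P : lmodType A)
    (s s' : seq (M * P)) : tensor_rel s s' ->
  exists e : seq P, forall (Q : P -> Prop) (lam : P -> A),
    (forall x, x \in e -> Q x) ->
    (forall x y, Q x -> Q y -> lam (x + y) = lam x + lam y) ->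
    (forall a x, Q x -> lam (a *: x) = a * lam x) ->
    \sum_(x <- s) lam x.2 *: x.1 = \sum_(x <- s') lam x.2 *: x.1.
Proof.
elim=> {s s'}.
- by move=> s; exists [::].
- by move=> s s' _ [e he]; exists e => Q lam *; rewrite (he Q).
- move=> s s' s'' _ [e he] _ [e' he']; exists (e ++ e') => Q lam h *.
  by rewrite (he Q) ?(he' Q) // => x hx; apply: h; rewrite mem_cat hx ?orbT.
- move=> s1 s1' s2 s2' _ [e he] _ [e' he']; exists (e ++ e') => Q lam h *.
  rewrite !big_cat /=; congr (_ + _); [apply: (he Q)|apply: (he' Q)] => // x hx;
    by apply: h; rewrite mem_cat hx ?orbT.
- by move=> s1 s2; exists [::] => Q lam *; rewrite !big_cat /= addrC.
- by move=> p; exists [::] => Q lam *; rewrite big_seq1 big_nil scaler0.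
- move=> m m' p; exists [::] => Q lam *.
  by rewrite big_seq1 big_cons big_seq1 scalerDr.
- move=> m p p'; exists [:: p; p'] => Q lam h hD hZ.
  rewrite big_seq1 big_cons big_seq1 hD ?scalerDl //; apply: h.
    exact: mem_head.
  by rewrite !inE eqxx orbT.
- move=> a m p; exists [:: p] => Q lam h hD hZ.
  by rewrite !big_seq1 hZ ?scalerA 1?mulrC //; apply: h; apply: mem_head.
Qed.

(** A submodule on which the identity factors linearly through a free module:
    the dual basis form of a finitely generated projective module. *)
Definition dual_basis (A : comPzRingType) (P : lmodType A) (Q : P -> Prop) :=
  exists r (b : 'I_r -> P) (lam : 'I_r -> P -> A),
    [/\ forall l x y, Q x -> Q y -> lam l (x + y) = lam l x + lam l y,
        forall l a x, Q x -> lam l (a *: x) = a * lam l x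
      & forall x, Q x -> x = \sum_l lam l x *: b l].

Lemma pure_sumr (A : comPzRingType) (M P : lmodType A) (m : M)
    (T : Type) (r : seq T) (F : T -> P) :
  pure_tensor m (\sum_(i <- r) F i) = \sum_(i <- r) pure_tensor m (F i).
Proof.
apply: (big_morph _ (pureDr m)).
by apply: (addrI (pure_tensor m 0)); rewrite -pureDr !addr0.
Qed.

Lemma pure_suml (A : comPzRingType) (M P : lmodType A) (p : P)
    (T : Type) (r : seq T) (F : T -> M) :
  pure_tensor (\sum_(i <- r) F i) p = \sum_(i <- r) pure_tensor (F i) p.
Proof.
apply: (big_morph (fun m => pure_tensor m p)) => [m m'|]; first exact: pureDl.
by apply: (addrI (pure_tensor 0 p)); rewrite -pureDl !addr0.
Qed.

(** The dual basis of a submodule that contains the second components of two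
    tensors and of a derivation of the equality of their images turns this
    equality into one between finitely many elements of the first factor, where
    f is injective. *)
Lemma tensor_map_inj (A : comPzRingType) (P : lmodType A) :
  (forall e : seq P, exists Q : P -> Prop,
     (forall x, x \in e -> Q x) /\ dual_basis Q) ->
  forall (M N : lmodType A) (f : {linear M -> N}),
    injective f -> injective (tensor_map (N := P) f).
Proof.
move=> h M N f f_inj p q.
pose fs (s : seq (M * P)) := [seq (f x.1, x.2) | x <- s].
have fE (u : tensor M P) : tensor_map (N := P) f u = cls (tensor_eqv N P) (fs (rep u)).
  by rewrite tensor_sum big_map.
rewrite !fE => /cls_eq/tensor_rel_functional [e he].
have [Q [hQ [r [b [lam [lamD lamZ lamE]]]]]] :=
  h (e ++ map snd (rep p) ++ map snd (rep q)).
have expand (u : tensor M P) : (forall x, x \in rep u -> Q x.2) ->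
    u = \sum_l pure_tensor (\sum_(x <- rep u) lam l x.2 *: x.1) (b l).
  move=> hu; rewrite [LHS]tensor_rep.
  transitivity (\sum_(x <- rep u) \sum_l pure_tensor (lam l x.2 *: x.1) (b l)).
    rewrite !big_seq; apply: eq_bigr => x /hu hx.
    rewrite [X in pure_tensor _ X](lamE _ hx).
    by rewrite pure_sumr; apply: eq_bigr => l _; rewrite pureZ.
  by rewrite exchange_big; apply: eq_bigr => l _; rewrite pure_suml.
refine (etrans (expand p _) (etrans _ (esym (expand q _)))).
- by move=> x hx; apply: hQ; rewrite !mem_cat (map_f snd hx) !orbT.
- apply: eq_bigr => l _; congr (pure_tensor _ _); apply: f_inj.
  rewrite !raddf_sum.
  have := he Q (lam l); rewrite !big_map /= => he'.
  under eq_bigr do rewrite linearZ; under [RHS]eq_bigr do rewrite linearZ.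
  apply: he' => [x hx||]; [by apply: hQ; rewrite mem_cat hx|exact: lamD|exact: lamZ].
- by move=> x hx; apply: hQ; rewrite !mem_cat (map_f snd hx) !orbT.
Qed.

Section TorsionFree.
Variables (k : fieldType) (P : lmodType (fps k)).
Hypothesis t_reg : forall x : P, fps_t k *: x = 0 -> x = 0.

Lemma tn_reg v (x : P) : fps_t k ^+ v *: x = 0 -> x = 0.
Proof.
elim: v => [|v IH]; first by rewrite expr0 scale1r.
by rewrite exprS -scalerA => /t_reg.
Qed.

(** k[[t]] is a valuation ring: after division by the largest common power of
    t, one coefficient of a linear relation is a unit. *)
Lemma unit_relation r (b : 'I_r -> P) (c : 'I_r -> fps k) i :
  \sum_l c l *: b l = 0 -> c i <> 0 ->
  exists (c' : 'I_r -> fps k) j, c' j = 1 /\ \sum_l c' l *: b l = 0.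
Proof.
move=> rel ci.
have ex : exists v, [exists l, c l v != 0].
  apply: contrapT => h; apply: ci; apply/funext => v; rewrite fps0.
  by apply/eqP/negPn/negP => hv; apply: h; exists v; apply/existsP; exists i.
case: (ex_minnP ex) => v /existsP[j hj] vmin.
pose u l : fps k := fun d => c l (d + v)%N.
have cE l : c l = fps_t k ^+ v * u l.
  apply/funext => d; rewrite fps_tnM /u; case: leqP => [/subnK-> //|hd].
  apply/eqP; apply: contraTT hd => hd; rewrite -leqNgt.
  by apply: vmin; apply/existsP; exists l.
have [|w hw] := @fps_inv k (u j); first by rewrite /u add0n.
(* Dividing by the unit u j normalizes the coefficient of b j to 1. *)
exists (fun l => w * u l), j; split=> //.
under eq_bigr do rewrite -scalerA.
rewrite -scaler_sumr (_ : \sum_l _ = 0) ?scaler0 //.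
apply: (@tn_reg v); rewrite scaler_sumr -[RHS]rel.
by apply: eq_bigr => l _; rewrite scalerA -cE.
Qed.

Definition submodule (Q : P -> Prop) :=
  [/\ Q 0, forall x y, Q x -> Q y -> Q (x + y) & forall a x, Q x -> Q (a *: x)].

(** Induction on the number of generators: as long as they satisfy a relation,
    one of them is a combination of the others and can be dropped; independent
    generators have coordinate functions. *)
Lemma torsion_free_dual_basis r (b : 'I_r -> P) :
  exists Q : P -> Prop, [/\ submodule Q, forall l, Q (b l) & dual_basis Q].
Proof.
elim: r b => [|r IH] b.
  exists (fun x => x = 0); split=> [||]; last 2 first.
  - by case.
  - exists 0%N, (fun=> 0), (fun _ _ => 0); split=> [[] //|[] //|x ->].
    by rewrite big_ord0.
  by split=> [|x y -> ->|a x ->] //; rewrite ?addr0 ?scaler0.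
have [dep|indep] := pselect (exists c : 'I_r.+1 -> fps k,
    \sum_l c l *: b l = 0 /\ exists i, c i <> 0).
  have [c [/unit_relation rel [i /rel [c' [j [cj rel']]]]]] := dep.
  have [Q [subQ hQ dQ]] := IH (b \o lift j); exists Q; split=> // l.
  have [<-|/unlift_some[l' -> _]] := eqVneq j l; last exact: hQ.
  have [Q0 QD QZ] := subQ.
  suff -> : b j = -1 *: \sum_l' c' (lift j l') *: b (lift j l').
    by apply: (QZ); apply: big_ind => // l' _; apply: QZ; apply: hQ.
  move: rel'; rewrite (bigD1_ord j) //= cj scale1r scaleN1r => /eqP.
  by rewrite addr_eq0 => /eqP.
have uniqc (c c' : 'I_r.+1 -> fps k) :
    \sum_l c l *: b l = \sum_l c' l *: b l -> forall i, c i = c' i.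
  move=> e i; apply/subr0_eq; apply: contrapT => h; apply: indep.
  exists (fun l => c l - c' l); split; last by exists i.
  under eq_bigr do rewrite scalerBl.
  by rewrite sumrB e subrr.
exists (fun x => exists c, x = \sum_l c l *: b l); split.
- split=> [|_ _ [c ->] [c' ->]|a _ [c ->]].
  + by exists (fun=> 0); rewrite big1 // => l _; rewrite scale0r.
  + exists (fun l => c l + c' l); rewrite -big_split.
    by apply: eq_bigr => l _; rewrite scalerDl.
  + exists (fun l => a * c l); rewrite scaler_sumr.
    by apply: eq_bigr => l _; rewrite scalerA.
- move=> i; exists (fun l => (l == i)%:R); rewrite (bigD1 i) //= eqxx scale1r.
  by rewrite big1 ?addr0 // => l /negPf->; rewrite scale0r.
pose lam l x : fps k :=
  if pselect (exists c, x = \sum_l c l *: b l) is left h then projT1 (cid h) l else 0.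
have lamE c l : lam l (\sum_l c l *: b l) = c l.
  rewrite /lam; case: pselect => [h|[]]; last by exists c.
  by apply: uniqc; case: cid.
exists r.+1, b, lam; split=> [l _ _ [c ->] [c' ->]|l a _ [c ->]|_ [c ->]].
- rewrite -big_split; under eq_bigr do rewrite /= -scalerDl.
  by rewrite !lamE.
- rewrite scaler_sumr; under eq_bigr do rewrite scalerA.
  by rewrite !lamE.
by apply: eq_bigr => l _; rewrite lamE.
Qed.

End TorsionFree.

(** A module without t-torsion over k[[t]] is a directed union of finitely
    generated free modules. *)
Lemma flat_of_torsion_free (k : fieldType) (B : comPzRingType)
    (phi : {rmorphism fps k -> B}) :
  (forall x, phi (fps_t k) * x = 0 -> x = 0) -> flat phi.
Proof.
move=> reg; apply: tensor_map_inj => e.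
have [|Q [_ hQ dQ]] := @torsion_free_dual_basis k (restr phi) _ _
  (fun l : 'I_(size e) => e`_l); first exact: reg.
exists Q; split=> // x /(nthP 0)[i hi <-].
exact: (hQ (Ordinal hi)).
Qed.

(** * Power series in several variables *)

Section MultivariateSeriesTheory.
Variables (n : nat) (A : comNzRingType).
Implicit Types f g : mps n A.

Lemma mpsD f g m : (f + g) m = f m + g m. Proof. by []. Qed.
Lemma mpsB f g m : (f - g) m = f m - g m. Proof. by []. Qed.
Lemma mps0 m : (0 : mps n A) m = 0.
Proof. by rewrite /GRing.zero /= /mps_const if_same. Qed.
Lemma mps_sum (T : Type) (r : seq T) (P : pred T) (F : T -> mps n A) m :
  (\sum_(i <- r | P i) F i) m = \sum_(i <- r | P i) F i m.
Proof. exact: (big_morph (fun f : mps n A => f m) (fun f g => mpsD f g m) (mps0 m)). Qed.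

Lemma mps_constM (a : A) f m : (@mps_const n _ a * f) m = a * f m.
Proof. exact: mps_mul_const. Qed.

Lemma mpsM_pair d f g m : (mdeg m < d)%N -> (f * g) m =
  \sum_(k : 'X_{1..n < d, d} | m == (k.1 + k.2)%MM) f k.1 * g k.2.
Proof.
move=> h; rewrite -[LHS](mps_trunc_mul f g h) [LHS](mcoeff_poly_mul _ _ h).
apply: eq_bigr => k _; rewrite !mps_truncE //; exact: bmdeg.
Qed.

Lemma mpsM d f g m : (mdeg m < d)%N -> (f * g) m =
  \sum_(k : 'X_{1..n < d} | (k <= m)%MM) f k * g (m - k)%MM.
Proof.
move=> h; rewrite -[LHS](mps_trunc_mul f g h) [LHS](@mcoeff_poly_mul_lin _ _ _ _ _ _ h).
apply: eq_bigr => k _; rewrite !mps_truncE ?bmdeg //.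
by rewrite (leq_ltn_trans _ h) // mdegB.
Qed.

Definition mps_monom (k : 'X_{1..n}) : mps n A := fun m => (m == k)%:R.

Lemma mps_monomM k g m :
  (mps_monom k * g) m = if (k <= m)%MM then g (m - k)%MM else 0.
Proof.
rewrite (mpsM (d := (maxn (mdeg m) (mdeg k)).+1)); last by rewrite ltnS leq_maxl.
case: ifP => hk; last first.
  rewrite big1 // => l hl; rewrite /mps_monom; case: eqP => [e|]; last by rewrite mul0r.
  by rewrite -e hl in hk.
have hd : (mdeg k < (maxn (mdeg m) (mdeg k)).+1)%N by rewrite ltnS leq_maxr.
rewrite (bigD1 (BMultinom hd)) //= /mps_monom eqxx mul1r big1 ?addr0 // => l.
move=> /andP[_ hl]; case: eqP => [e|]; last by rewrite mul0r.
by case/eqP: hl; apply: val_inj.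
Qed.

Lemma mps_monomD k l : mps_monom (k + l)%MM = mps_monom k * mps_monom l.
Proof.
apply/funext => m; rewrite mps_monomM /mps_monom; case: ifP => hk.
  have -> : (m == k + l)%MM = (m - k == l)%MM; last by [].
    apply/eqP/eqP => [->|<-]; first by rewrite addmC addmK.
    by rewrite addmC submK.
by case: eqP => // e; rewrite e lem_addr in hk.
Qed.

Lemma mps_monom_var i : mps_monom U_(i) = mps_var A i.
Proof. by []. Qed.

Lemma mps_monom0 : mps_monom 0%MM = 1.
Proof.
by apply/funext => m; rewrite /GRing.one /= /mps_monom /mps_const; case: eqP.
Qed.

Lemma mps_monomE k : mps_monom k = \prod_(i < n) mps_var A i ^+ k i.
Proof.
rewrite {1}(multinomUE_id k) (big_morph _ mps_monomD mps_monom0).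
apply: eq_bigr => i _; elim: (k i) => [|d IH]; first by rewrite mulm0n mps_monom0.
by rewrite mulmS mps_monomD IH exprS.
Qed.

(** ** The order filtration is the (x_1, ..., x_n)-adic filtration *)

Definition order_ge j f := forall m, (mdeg m < j)%N -> f m = 0.

Lemma order_geM i j f g : order_ge i f -> order_ge j g -> order_ge (i + j) (f * g).
Proof.
move=> hf hg m hm; rewrite (mpsM _ _ (ltnSn _)) big1 // => k hk.
have [h|h] := ltnP (mdeg k) i; first by rewrite hf ?mul0r.
rewrite hg ?mulr0 //; have := mdegD (m - k)%MM k; rewrite submK //; lia.
Qed.

(** A series without constant term is a combination of the variables: each
    of its monomials is assigned to one variable that divides it. *)
Lemma order_ge_pow j f : order_ge j f -> ideal_pow (mps_ideal n A) j f.
Proof.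
elim: j f => [|j IH] f // hf.
pose i0 (m : 'X_{1..n}) := [pick i | m i != 0%N].
have i0P m : m != 0%MM -> exists2 i, i0 m = Some i & m i != 0%N.
  move=> hm; rewrite /i0; case: pickP => [i hi|h]; first by exists i.
  by case/eqP: hm; apply/mnmP => i; rewrite mnm0E; apply/eqP/negbFE/h.
pose g i : mps n A := fun m => if i0 (m + U_(i))%MM == Some i then f (m + U_(i))%MM else 0.
suff -> : f = \sum_i mps_var A i * g i.
  apply: ideal_sum => i _; apply: ideal_span_in; exists (mps_var A i), (g i).
  split; first by apply: ideal_span_in; exists i.
  split=> //; apply: IH => m hm; rewrite /g; case: ifP => // _.
  by apply: hf; rewrite mdegD mdeg1; lia.
apply/funext => m; rewrite mps_sum.
have gE i : (mps_var A i * g i) m = if i0 m == Some i then f m else 0.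
  rewrite -mps_monom_var mps_monomM lep1mP; case: eqP => /= [mi|/eqP mi].
    rewrite /i0; case: pickP => [l hl|//]; case: eqP => [[e]|//].
    by rewrite e mi in hl.
  by rewrite /g submK // lep1mP.
rewrite (eq_bigr _ (fun i _ => gE i)).
have [->|/i0P[i -> _]] := eqVneq m 0%MM.
  by rewrite hf ?mdeg0 // big1 // => i _; rewrite if_same.
rewrite (bigD1 i) //= eqxx big1 ?addr0 // => l hl.
by case: eqP => // -[e]; rewrite e eqxx in hl.
Qed.

Lemma pow_order_ge j f : ideal_pow (mps_ideal n A) j f -> order_ge j f.
Proof.
have order_ideal i : exists J : ideal (mps n A), forall x, J x <-> order_ge i x.
  suff h : [/\ order_ge i 0, forall x y, order_ge i x -> order_ge i y -> order_ge i (x + y)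
      & forall a x, order_ge i x -> order_ge i (a * x)].
    by case: h => h1 h2 h3; exists (Ideal h1 h2 h3).
  split=> [m _|x y hx hy m hm|a x hx]; first exact: mps0.
    by rewrite mpsD hx ?hy ?addr0.
  exact: (@order_geM 0).
elim: j f => [|j IH] f //= hf.
have [J JE] := order_ideal j.+1; apply/JE; apply: (ideal_gen_sub _ hf).
move=> _ [a [b [ha [hb ->]]]]; apply/JE/(@order_geM 1); last exact: IH.
have [K KE] := order_ideal 1%N; apply/KE; apply: (ideal_gen_sub _ ha).
move=> _ [i ->]; apply/KE => m; rewrite ltnS leqn0 mdeg_eq0 => /eqP->.
by rewrite /mps_var eq_sym mnm1_eq0.
Qed.

(** ** Homogeneous components and the dilation f(x) |-> f(tx) *)

Lemma hcompE i f m : hcomp i f m = if mdeg m == i then f m else 0.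
Proof. by []. Qed.

Lemma hcomp_order_ge i f : order_ge i (hcomp i f).
Proof. by move=> m hm; rewrite hcompE ltn_eqF. Qed.

Lemma hcomp_sub_order_ge i f : order_ge i f -> order_ge i.+1 (f - hcomp i f).
Proof.
move=> hf m; rewrite ltnS leq_eqVlt mpsB hcompE => /orP[h|h].
  by rewrite h subrr.
by rewrite hf // if_same subrr.
Qed.

Lemma hcompM i f g :
  hcomp i (f * g) = \sum_(j < i.+1) hcomp j f * hcomp (i - j) g.
Proof.
apply/funext => m; rewrite mps_sum hcompE.
under eq_bigr do rewrite (mpsM _ _ (ltnSn (mdeg m))).
rewrite exchange_big /= (mpsM _ _ (ltnSn (mdeg m))).
have deg (k : 'X_{1..n}) : (k <= m)%MM -> (mdeg (m - k) + mdeg k = mdeg m)%N.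
  by move=> h; rewrite -mdegD submK.
case: eqP => [e|ne].
  apply: eq_bigr => k /deg hk.
  have hki : (mdeg k < i.+1)%N by lia.
  rewrite (bigD1 (Ordinal hki)) //= !hcompE eqxx.
  rewrite (_ : mdeg (m - k)%MM == _); last by apply/eqP; lia.
  rewrite big1 ?addr0 // => j hj; rewrite hcompE; case: eqP; last by rewrite mul0r.
  by move=> e'; case/eqP: hj; apply: val_inj.
rewrite big1 // => k /deg hk; rewrite big1 // => j _; rewrite !hcompE.
case: eqP => [e1|]; last by rewrite mul0r.
case: eqP => [e2|]; last by rewrite mulr0.
by have := ltn_ord j; lia.
Qed.

Lemma hcomp_const i (a : A) : hcomp i (@mps_const n _ a) = if i == 0%N then @mps_const n _ a else 0.
Proof.
apply/funext => m; rewrite hcompE (fun_if (fun f : mps n A => f m)) mps0 /mps_const.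
have [->|hm] := eqVneq m 0%MM; first by rewrite mdeg0 eq_sym.
by rewrite !if_same.
Qed.

Definition dilation f : fps (mps n A) := fun i => hcomp i f.

Fact dilation_zmod : zmod_morphism dilation.
Proof.
move=> f g; apply/funext => i; apply/funext => m.
by rewrite fpsB mpsB /dilation !hcompE mpsB; case: ifP; rewrite ?subrr.
Qed.
HB.instance Definition _ :=
  GRing.isZmodMorphism.Build (mps n A) (fps (mps n A)) dilation dilation_zmod.
Fact dilation_monoid : monoid_morphism dilation.
Proof.
split; last by move=> f g; apply/funext => i; rewrite /dilation hcompM.
apply/funext => i; rewrite fps1 /dilation -(rmorph1 (@mps_const n A)) hcomp_const.
by case: eqP; rewrite ?rmorph1 ?rmorph0.
Qed.
HB.instance Definition _ :=
  GRing.isMonoidMorphism.Build (mps n A) (fps (mps n A)) dilation dilation_monoid.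

Lemma dilation_const (a : A) : dilation (@mps_const n _ a) = fps_const (@mps_const n _ a).
Proof. by apply/funext => i; rewrite /dilation hcomp_const /fps_const. Qed.

Lemma dilation_var i :
  dilation (mps_var A i) = fps_t (mps n A) * fps_const (mps_var A i).
Proof.
apply/funext => j; rewrite fps_tM; apply/funext => m; rewrite /dilation hcompE.
have e l : fps_const (mps_var A i) l m = if l == 0%N then mps_var A i m else 0.
  by rewrite /fps_const; case: eqP; rewrite ?mps0.
rewrite /mps_var in e *; move: e; have [->|/negPf hm] := eqVneq m U_(i)%MM => e.
  rewrite mdeg1; case: j => [|j] /=; first by rewrite mps0.
  by rewrite e; case: j.
by rewrite if_same; case: j => [|j]; rewrite ?mps0 // e if_same.
Qed.

(** ** Evaluation of power series at nilpotent elements *)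

Section Evaluation.
Variables (C : comPzRingType) (theta : {rmorphism A -> C}) (c : 'I_n -> C) (j : nat).
Let cm (m : 'X_{1..n}) := \prod_(i < n) c i ^+ m i.

(** If all monomials of degree at least j in the c i vanish, evaluation at c is
    a finite sum and thus makes sense in any ring, without topology. *)
Definition nilpotent_ev of (forall m : 'X_{1..n}, (j <= mdeg m)%N -> \prod_(i < n) c i ^+ m i = 0) :=
  fun f => \sum_(k : 'X_{1..n < j}) theta (f k) * \prod_(i < n) c i ^+ k i.

Hypothesis nil : forall m : 'X_{1..n}, (j <= mdeg m)%N -> \prod_(i < n) c i ^+ m i = 0.
Let ev := nilpotent_ev nil.

Let cmD k l : cm (k + l)%MM = cm k * cm l.
Proof. by rewrite -big_split; apply: eq_bigr => i _; rewrite mnmDE exprD. Qed.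

Fact nilpotent_ev_zmod : zmod_morphism ev.
Proof.
move=> f g; rewrite -sumrB; apply: eq_bigr => k _.
by rewrite mpsB rmorphB mulrBl.
Qed.
HB.instance Definition _ := GRing.isZmodMorphism.Build (mps n A) C ev nilpotent_ev_zmod.

Lemma nilpotent_ev_monom k : nilpotent_ev nil (mps_monom k) = \prod_(i < n) c i ^+ k i.
Proof.
rewrite /nilpotent_ev /mps_monom; have [h|h] := leqP j (mdeg k).
  rewrite (nil h) big1 // => l _; case: eqP => [e|_]; last by rewrite rmorph0 mul0r.
  by have := bmdeg l; rewrite e ltnNge h.
rewrite (bigD1 (BMultinom h)) //= eqxx rmorph1 mul1r [X in _ + X]big1 ?addr0 // => l hl.
case: eqP => [e|_]; last by rewrite rmorph0 mul0r.
by case/eqP: hl; apply: val_inj.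
Qed.

Fact nilpotent_ev_monoid : monoid_morphism ev.
Proof.
split=> [|f g].
  rewrite -mps_monom0 /ev nilpotent_ev_monom big1 // => i _.
  by rewrite mnm0E expr0.
rewrite [RHS]big_distrlr /=.
transitivity (\sum_(m : 'X_{1..n < j}) \sum_(k : 'X_{1..n < j})
    \sum_(l : 'X_{1..n < j} | bmnm m == (k + l)%MM)
       theta (f k) * theta (g l) * cm m).
  apply: eq_bigr => m _.
  rewrite (mpsM_pair _ _ (bmdeg m)) rmorph_sum mulr_suml /=.
  rewrite (pair_big_dep xpredT (fun k l : 'X_{1..n < j} => bmnm m == (k + l)%MM)
    (fun k l => theta (f k) * theta (g l) * cm m)) /=.
  by apply: eq_bigr => k _; rewrite rmorphM.
rewrite exchange_big; apply: eq_bigr => k _ /=.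
rewrite (exchange_big_dep xpredT) //=; apply: eq_bigr => l _.
rewrite -[theta (f k) * _ * (_ * _)]mulrACA -/(cm k) -/(cm l) -cmD.
have [h|h] := leqP j (mdeg (k + l)%MM).
  rewrite /cm (nil h) mulr0 big1 // => m /eqP e.
  by have := bmdeg m; rewrite e ltnNge h.
by rewrite (big_pred1 (BMultinom h)).
Qed.
HB.instance Definition _ := GRing.isMonoidMorphism.Build (mps n A) C ev nilpotent_ev_monoid.

Lemma nilpotent_ev_var i : nilpotent_ev nil (mps_var A i) = c i.
Proof.
rewrite -mps_monom_var nilpotent_ev_monom (bigD1 i) //= mnm1E eqxx expr1.
by rewrite big1 ?mulr1 // => l /negPf hl; rewrite mnm1E eq_sym hl expr0.
Qed.

Lemma nilpotent_ev_const (a : A) : nilpotent_ev nil (@mps_const n _ a) = theta a.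
Proof.
rewrite /nilpotent_ev; have [h|h] := posnP j.
  have c1 : (1 : C) = 0.
    rewrite -(@nil 0%MM) ?h // big1 // => i _; by rewrite mnm0E expr0.
  by rewrite -[LHS]mulr1 -[RHS]mulr1 c1 !mulr0.
have h0 : (mdeg (0%MM : 'X_{1..n}) < j)%N by rewrite mdeg0.
rewrite (bigD1 (BMultinom h0)) //= [X in _ + X]big1 => [|l hl].
  rewrite addr0 /mps_const eqxx big1 ?mulr1 // => i _; by rewrite mnm0E expr0.
rewrite /mps_const; case: eqP => [e|_]; last by rewrite rmorph0 mul0r.
by case/eqP: hl; apply: val_inj.
Qed.

End Evaluation.

(** A ring morphism that kills a power of (x_1, ..., x_n) only sees finitely
    many coefficients, hence is determined by constants and variables. *)
Lemma mps_morph_eq (C : comPzRingType) (F G : {rmorphism mps n A -> C}) j :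
  (forall f, ideal_pow (mps_ideal n A) j f -> F f = 0) ->
  (forall f, ideal_pow (mps_ideal n A) j f -> G f = 0) ->
  (forall a, F (@mps_const n _ a) = G (@mps_const n _ a)) ->
  (forall i, F (mps_var A i) = G (mps_var A i)) ->
  forall f, F f = G f.
Proof.
move=> F0 G0 hc hv f.
pose p := \sum_(k : 'X_{1..n < j}) @mps_const n _ (f k) * mps_monom k.
have hp : ideal_pow (mps_ideal n A) j (f - p).
  apply: order_ge_pow => m hm; rewrite mpsB /p mps_sum.
  rewrite (bigD1 (BMultinom hm)) //= mps_constM /mps_monom eqxx mulr1.
  rewrite big1 ?addr0 ?subrr // => l hl; rewrite mps_constM.
  case: eqP => [e|]; last by rewrite mulr0.
  by case/eqP: hl; apply: val_inj.
have e : F p = G p.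
  rewrite !rmorph_sum; apply: eq_bigr => k _; rewrite !rmorphM hc mps_monomE.
  congr (_ * _); rewrite !rmorph_prod; apply: eq_bigr => i _.
  by rewrite !rmorphXn hv.
by rewrite -[f](subrK p) (rmorphD F) (rmorphD G) e (F0 _ hp) (G0 _ hp).
Qed.

End MultivariateSeriesTheory.

(** S[[t]] and k[[t]][[x]] are the same ring of arrays of coefficients. *)
Section Swap.
Variables (n : nat) (k : comNzRingType).

Definition swap_series (g : fps (mps n k)) : mps n (fps k) := fun m i => g i m.

Fact swap_zmod : zmod_morphism swap_series.
Proof. by []. Qed.
HB.instance Definition _ := GRing.isZmodMorphism.Build
  (fps (mps n k)) (mps n (fps k)) swap_series swap_zmod.
Fact swap_monoid : monoid_morphism swap_series.
Proof.
split=> [|f g]; apply/funext => m; apply/funext => i.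
  have one (B : comNzRingType) (l : 'X_{1..n}) : (1 : mps n B) l = (l == 0%MM)%:R.
    by rewrite -mps_monom0.
  rewrite /swap_series fps1 one; case: i => [|i].
    by rewrite mulr1n one; case: eqP => _; rewrite ?fps1 ?fps0.
  by rewrite mulr0n mps0; case: eqP => _; rewrite ?fps1 ?fps0.
rewrite /swap_series fpsM mps_sum (mpsM _ _ (ltnSn _)).
have fps_sum (T : Type) (r : seq T) (P : pred T) (F : T -> fps k) :
    (\sum_(l <- r | P l) F l) i = \sum_(l <- r | P l) F l i.
  exact: (big_morph (fun f : fps k => f i) (fun f g => fpsD f g i) (fps0 _ i)).
under eq_bigr do rewrite (mpsM _ _ (ltnSn (mdeg m))).
by rewrite fps_sum exchange_big.
Qed.
HB.instance Definition _ := GRing.isMonoidMorphism.Build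
  (fps (mps n k)) (mps n (fps k)) swap_series swap_monoid.

Definition unswap_series (g : mps n (fps k)) : fps (mps n k) := fun i m => g m i.
Lemma swapK : cancel swap_series unswap_series. Proof. by []. Qed.
Lemma unswapK : cancel unswap_series swap_series. Proof. by []. Qed.

End Swap.

(** * Division of power series and standard bases *)

(** Induction on the number d of coordinates that are compared.  A finite set
    s0 that works for d coordinates also works for d + 1 on the monomials
    whose next exponent is at least its maximum N over s0.  The other
    monomials are spread over N slices where that exponent is constant. *)
Lemma dickson n (L : 'X_{1..n} -> Prop) : exists s : seq 'X_{1..n},
  (forall m, m \in s -> L m) /\
  forall m, L m -> exists2 m', m' \in s & (m' <= m)%MM.
Proof.
suff H d : forall L : 'X_{1..n} -> Prop, exists s : seq 'X_{1..n},
    (forall m, m \in s -> L m) /\ forall m, L m ->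
      exists2 m', m' \in s & forall i : 'I_n, (i < d)%N -> (m' i <= m i)%N.
  have [s [sL sP]] := H n L; exists s; split=> // m /sP[m' hm' h].
  by exists m' => //; apply/mnm_lepP => i; apply: h.
elim: d => [|d IH] {}L.
  have [[m Lm]|nL] := pselect (exists m, L m); last first.
    by exists [::]; split=> // m Lm; case: nL; exists m.
  exists [:: m]; split=> [m'|m' _]; first by rewrite inE => /eqP->.
  by exists m => //; apply: mem_head.
have [hd|hd] := ltnP d n; last first.
  have [s [sL sP]] := IH L; exists s; split=> // m /sP[m' hm' h].
  by exists m' => // i _; apply: h; apply: leq_trans hd.
pose x := Ordinal hd.
have [s0 [s0L s0P]] := IH L.
pose N := \max_(m <- s0) m x.
pose S c := projT1 (cid (IH (fun m => L m /\ m x = c))).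
have SL c m : m \in S c -> L m /\ m x = c.
  by rewrite /S; case: cid => s [h _] /=; apply: h.
have SP c m : L m -> m x = c ->
    exists2 m', m' \in S c & forall i : 'I_n, (i < d)%N -> (m' i <= m i)%N.
  by rewrite /S; case: cid => s [_ h] /= *; apply: h.
exists (s0 ++ flatten [seq S c | c <- iota 0 N]); split=> m.
  rewrite mem_cat => /orP[/s0L //|/flatten_mapP[c _ /SL[]]].
  by [].
have cmp (m' : 'X_{1..n}) : (m' x <= m x)%N ->
    (forall i : 'I_n, (i < d)%N -> (m' i <= m i)%N) ->
    forall i : 'I_n, (i < d.+1)%N -> (m' i <= m i)%N.
  move=> hx h i; rewrite ltnS leq_eqVlt => /orP[/eqP e|/h //].
  by rewrite (_ : i = x) //; apply: val_inj.
move=> Lm; have [h|h] := ltnP (m x) N.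
  have [m' hm' hle] := SP _ _ Lm erefl; exists m'.
    rewrite mem_cat; apply/orP; right; apply/flatten_mapP; exists (m x) => //.
    by rewrite mem_iota.
  by apply: cmp hle; have [_ ->] := SL _ _ hm'.
have [m' hm' hle] := s0P _ Lm; exists m'; first by rewrite mem_cat hm'.
apply: cmp hle; apply: leq_trans h.
exact: (@leq_bigmax_seq _ _ xpredT (fun m : 'X_{1..n} => m x)).
Qed.

Section Division.
Variables (n : nat) (k : fieldType).
Implicit Types f g : mps n k.

(** Power series have no greatest monomial: the leading one is the least for a
    well-founded total order that refines the degree, so that its degree is
    the order of the series. *)
Definition lead f (m : 'X_{1..n}) :=
  f m != 0 /\ forall m', f m' != 0 -> (m <= m')%O.

Lemma lead_exists f : f <> 0 -> exists m, lead f m.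
Proof.
move=> f0; apply: contrapT => h; apply: f0; apply/funext => m; rewrite mps0.
elim/(well_founded_ind (@ltom_wf n)): m => m IH; apply/eqP/negPn/negP => hm.
apply: h; exists m; split=> // m' hm'; rewrite leNgt; apply/negP => /IH e.
by rewrite e eqxx in hm'.
Qed.

Section DivisionBy.
Variables (r : nat) (F : 'I_r -> mps n k) (l : 'I_r -> 'X_{1..n}).
Hypothesis Fl : forall i, lead (F i) (l i).

Let idx (m : 'X_{1..n}) : option 'I_r := [pick i | (l i <= m)%MM].

(** Every monomial m in the ideal generated by the l i is assigned to one
    divisor F i with l i dividing m.  The unknown c m is the leading
    coefficient of the multiple of F i with leading monomial m that is to be
    subtracted; for the remaining monomials it is the coefficient of the
    remainder. *)
Let q (c : 'X_{1..n} -> k) i : mps n k := fun a =>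
  if idx (a + l i)%MM == Some i then c (a + l i)%MM / F i (l i) else 0.
Let rem (c : 'X_{1..n} -> k) : mps n k := fun m => if idx m == None then c m else 0.
Let Phi c : mps n k := \sum_i q c i * F i + rem c.

Let q_mul_lead c i m : (forall m', (m' < m)%O -> c m' = 0) ->
  (q c i * F i) m = if idx m == Some i then c m else 0.
Proof.
move=> c0; have [F0 Fle] := Fl i.
have term a : (a <= m)%MM -> (a + l i)%MM != m -> q c i a * F i (m - a)%MM = 0.
  move=> ham hne; rewrite /q; case: eqP => _; last by rewrite mul0r.
  have [->|/Fle hl] := eqVneq (F i (m - a)%MM) 0; first by rewrite mulr0.
  rewrite c0 ?mul0r // lt_neqAle hne /= -[leRHS](submK ham) addmC.
  by rewrite lemc_add2l.
rewrite (mpsM _ _ (ltnSn _)); have [hl|hl] := boolP (l i <= m)%MM; last first.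
  rewrite big1 => [|a ha].
    by rewrite /idx; case: pickP => // i' hi'; case: eqP => // -[e]; rewrite e (negPf hl) in hi'.
  by apply: term => //; apply: contra hl => /eqP <-; apply: lem_addl.
have hd : (mdeg (m - l i)%MM < (mdeg m).+1)%N by rewrite ltnS mdegB.
rewrite (bigD1 (BMultinom hd)) /=; last by apply: lem_subr.
rewrite big1 => [|a /andP[ham ha]]; last first.
  apply: term => //; apply: contra ha => /eqP e; apply/eqP/val_inj.
  by rewrite /= -[X in (X - _)%MM]e addmK.
rewrite addr0 /q submK // submBA // addmC addmK.
by case: eqP => _; rewrite ?mul0r // divfK.
Qed.

(* For c vanishing below m this says that the linear system is
   unitriangular. *)
Let Phi_lead c m : (forall m', (m' < m)%O -> c m' = 0) -> Phi c m = c m.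
Proof.
move=> c0; rewrite /Phi mpsD mps_sum; under eq_bigr do rewrite q_mul_lead //.
rewrite /rem; case: idx => [i|]; last by rewrite big1 ?add0r ?eqxx.
rewrite (bigD1 i) //= eqxx big1 ?addr0 // => j /negPf hj.
by rewrite (inj_eq Some_inj) eq_sym hj.
Qed.

Let Phi_sub c c' m : Phi c m - Phi c' m = Phi (fun a => c a - c' a) m.
Proof.
rewrite /Phi !mpsD opprD addrACA -mpsB -sumrB; congr (_ + _); last first.
  by rewrite /rem; case: ifP; rewrite ?subrr.
congr ((_ : mps n k) m); apply: eq_bigr => i _; rewrite -mulrBl; congr (_ * _).
apply/funext => a; rewrite mpsB /q; case: ifP; rewrite ?subrr //.
by rewrite mulrBl.
Qed.

(** Grauert-Hironaka division.  The quotients are found all at once, as the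
    solution of a linear system which is unitriangular for the monomial
    order. *)
Lemma mps_division f : exists (Q : 'I_r -> mps n k) (R : mps n k),
  [/\ f = \sum_i Q i * F i + R,
      forall i m, (l i <= m)%MM -> R m = 0
    & forall w, order_ge w f -> forall i, order_ge (w - mdeg (l i)) (Q i)].
Proof.
have [|c hc] := triangular_surj (@ltom_wf n) _ f (Phi := Phi).
  move=> c c' m e; have /eqP := Phi_sub c c' m; rewrite [X in _ == X]Phi_lead => [|m' /e]; last first.
    by move=> ->; rewrite subrr.
  by rewrite subr_eq => /eqP->; rewrite addrAC [c m - _]addrC addrK addrC.
exists (q c), (rem c); split.
- by apply/funext => m; rewrite -hc.
- move=> i m hi; rewrite /rem /idx; case: pickP => // h.
  by rewrite h in hi.
move=> w hf i a ha; rewrite /q; case: ifP => // _.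
(* By triangularity c vanishes wherever f vanishes up to that point, and the
   order of monomials refines the degree. *)
suff c0 m : (mdeg m < w)%N -> c m = 0 by rewrite c0 ?mul0r // mdegD; lia.
elim/(well_founded_ind (@ltom_wf n)): m => m IH hm.
rewrite -Phi_lead ?hc ?hf // => m' hm'; apply: IH => //.
by apply: leq_ltn_trans hm; apply/lemc_mdeg/ltW.
Qed.

End DivisionBy.

Lemma series_orderP f : f <> 0 ->
  order_ge (series_order f) f /\ exists2 m, mdeg m = series_order f & f m != 0.
Proof.
have hcomp_neq0 i : hcomp i f != 0 -> exists2 m, mdeg m = i & f m != 0.
  move=> h; apply: contrapT => h'; move/eqP: h; apply; apply/funext => m.
  rewrite hcompE mps0; case: eqP => // e; apply/eqP/negPn/negP => hm.
  by apply: h'; exists m.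
have neq0_hcomp m : f m != 0 -> hcomp (mdeg m) f != 0.
  apply: contra => /eqP/(congr1 (fun g : mps n k => g m)).
  by rewrite hcompE eqxx mps0 => ->.
move=> f0; rewrite /series_order; case: pselect => [ex|h]; last first.
  by have [m [hm _]] := lead_exists f0; case: h; exists (mdeg m); apply: neq0_hcomp.
case: ex_minnP => o /hcomp_neq0 ho omin; split=> // m hm.
by apply/eqP; apply: contraTT hm => /neq0_hcomp/omin; rewrite -leqNgt.
Qed.

Lemma lead_order f m : lead f m -> series_order f = mdeg m.
Proof.
move=> [fm fle]; have f0 : f <> 0 by move=> e; rewrite e mps0 eqxx in fm.
have [h [m' e /fle/lemc_mdeg hm']] := series_orderP f0; apply/eqP.
by rewrite eqn_leq -{2}e hm' andbT leqNgt; apply/negP => h0; rewrite (h _ h0) eqxx in fm.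
Qed.

(** By Dickson's lemma the leading monomials of finitely many elements F i of I
    generate those of I.  After division by the F i the remainder still lies
    in I, but none of its monomials is a leading monomial of I, so it
    vanishes. *)
Lemma standard_basis (I : ideal (mps n k)) : exists r (F : 'I_r -> mps n k),
  (forall i, F i <> 0 /\ I (F i)) /\
  forall w f, I f -> order_ge w f -> exists Q : 'I_r -> mps n k,
    f = \sum_i Q i * F i /\ forall i, order_ge (w - series_order (F i)) (Q i).
Proof.
have [s [sL sP]] := dickson (fun m => exists f, I f /\ lead f m).
have sN (i : 'I_(size s)) : exists f, I f /\ lead f (nth 0%MM s i).
  by apply/sL/mem_nth.
pose F i := projT1 (cid (sN i)).
have FI i : I (F i) by rewrite /F; case: cid => f [].
have Fl i : lead (F i) (nth 0%MM s i) by rewrite /F; case: cid => f [].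
exists (size s), F; split=> [i|w f If hf].
  by split=> // e; have [] := Fl i; rewrite e mps0 eqxx.
have [Q [R [fE R0 hQ]]] := mps_division Fl f.
exists Q; split=> [|i]; last by rewrite (lead_order (Fl i)); apply: hQ.
suff R_0 : R = 0 by rewrite {1}fE R_0 addr0.
apply: contrapT => /lead_exists [m [Rm Rle]].
have [|_ /(nthP 0%MM)[i hi <-] hle] := sP m; last first.
  by move: Rm; rewrite (R0 (Ordinal hi)) // eqxx.
exists R; split=> //; have -> : R = f - \sum_i Q i * F i by rewrite {1}fE addrC addKr.
by apply: ideal_B => //; apply: ideal_sum => i _; apply: ideal_M.
Qed.

(** * The homogenized ideal and flatness *)

(** With weight 1 for the x_i and weight -1 for t, this is the part of
    weight w of g in S[[t]], with t set to 1: a monomial x^m occurs in it with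
    t^(|m| - w). *)
Definition dehom (w : int) (g : fps (mps n k)) : mps n k := fun m =>
  if w <= (mdeg m)%:Z then g `|(mdeg m)%:Z - w|%N m else 0.

Lemma dehomD w (f g : fps (mps n k)) : dehom w (f + g) = dehom w f + dehom w g.
Proof.
apply/funext => m; rewrite mpsD /dehom; case: ifP; rewrite ?addr0 //.
Qed.

Lemma dehom0 w : dehom w 0 = 0.
Proof. by apply/funext => m; rewrite /dehom fps0 mps0 if_same. Qed.

Lemma dehom_sum w r (G : 'I_r -> fps (mps n k)) :
  dehom w (\sum_i G i) = \sum_i dehom w (G i).
Proof. exact: (big_morph _ (dehomD w) (dehom0 w)). Qed.

Lemma dehom_inj (f g : fps (mps n k)) : (forall w, dehom w f = dehom w g) -> f = g.
Proof.
move=> h; apply/funext => j; apply/funext => m.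
have := congr1 (fun u : mps n k => u m) (h ((mdeg m)%:Z - j%:Z)).
rewrite /dehom; have -> : (mdeg m)%:Z - j%:Z <= (mdeg m)%:Z by lia.
by have -> : absz ((mdeg m)%:Z - ((mdeg m)%:Z - j%:Z))%R = j by lia.
Qed.

Lemma dehom_t w (g : fps (mps n k)) : dehom w (fps_t (mps n k) * g) = dehom (w + 1) g.
Proof.
apply/funext => m; rewrite /dehom fps_tM.
have [h|h] := boolP (w + 1 <= (mdeg m)%:Z).
  rewrite (_ : w <= (mdeg m)%:Z); last by lia.
  by rewrite (_ : `|(mdeg m)%:Z - w|%N = (absz ((mdeg m)%:Z - (w + 1))%R).+1) //; lia.
case: ifP => // h'; rewrite (_ : `|(mdeg m)%:Z - w|%N = 0%N) ?mps0 //; lia.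
Qed.

Lemma dehom_order_ge w (g : fps (mps n k)) : order_ge (if 0 <= w then `|w|%N else 0%N) (dehom w g).
Proof. by move=> m; rewrite /dehom; case: ifP; case: ifP => //; lia. Qed.

(** hom(F) is homogeneous of weight o(F) and dehomogenizes to F, so it only
    multiplies the part of a of weight w - o(F). *)
Lemma dehom_mul_homogenize w a (F : mps n k) : F <> 0 ->
  dehom w (a * homogenize F) = dehom (w - (series_order F)%:Z) a * F.
Proof.
move=> /series_orderP [ordF _]; set o := series_order F in ordF *.
apply/funext => m; rewrite (mpsM _ _ (ltnSn _)) [in LHS]/dehom.
have deg (l : 'X_{1..n}) : (l <= m)%MM -> (mdeg (m - l) + mdeg l = mdeg m)%N.
  by move=> h; rewrite -mdegD submK.
case: ifP => hw; last first.
  rewrite big1 // => l /deg hl; rewrite /dehom; case: ifP => h; last by rewrite mul0r.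
  by rewrite ordF ?mulr0 //; lia.
set N := `|_|%N; rewrite fpsM mps_sum.
under eq_bigr do rewrite (mpsM _ _ (ltnSn (mdeg m))).
rewrite exchange_big; apply: eq_bigr => l /deg hl /=.
have [hF|hF] := ltnP (mdeg (m - l)%MM) o.
  rewrite ordF // mulr0 big1 // => j _.
  by rewrite /homogenize hcompE ordF // if_same mulr0.
rewrite /dehom; case: ifP => h; last first.
  rewrite mul0r big1 // => j _; rewrite /homogenize hcompE -/o.
  case: eqP => [e|]; last by rewrite mulr0.
  by have := ltn_ord j; exfalso; lia.
have hJ : (absz ((mdeg l)%:Z - (w - o%:Z))%R < N.+1)%N by lia.
rewrite (bigD1 (Ordinal hJ)) //= big1 ?addr0 => [|j hj].
  by rewrite /homogenize hcompE -/o; case: eqP => //; lia.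
rewrite /homogenize hcompE -/o; case: eqP => [e|]; last by rewrite mulr0.
case/eqP: hj; apply: val_inj => /=; have := ltn_ord j; lia.
Qed.

(** For the converse, expand the infinitely many components on a standard
    basis F with quotients of the largest possible order; the quotients of F i
    for the different weights are then the components of one series in x
    and t. *)
Lemma hom_idealP (I : ideal (mps n k)) (g : fps (mps n k)) :
  hom_ideal I g <-> forall w, I (dehom w g).
Proof.
split=> [hg w|hg].
  suff H a : I (dehom w (a * g)) by rewrite -[g]mul1r.
  elim: hg a w => {g} [_ [f [/eqP f0 [If ->]]]||f g _ hf _ hg|b f _ hf] a w.
  - by rewrite dehom_mul_homogenize //; apply: ideal_M.
  - by rewrite mulr0 dehom0; apply: ideal_0.
  - by rewrite mulrDr dehomD; apply: ideal_D.
  - by rewrite mulrA.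
have [r [F [FI Fdiv]]] := standard_basis I.
pose q w := projT1 (cid (Fdiv _ _ (hg w) (@dehom_order_ge w g))).
have qE w : dehom w g = \sum_i q w i * F i by rewrite /q; case: cid => Q [].
have qO w i : order_ge ((if (0 <= w)%R then `|w|%N else 0%N) - series_order (F i)) (q w i).
  by rewrite /q; case: cid => Q [].
pose Q i : fps (mps n k) := fun j m =>
  q ((mdeg m)%:Z - j%:Z + (series_order (F i))%:Z) i m.
suff -> : g = \sum_i Q i * homogenize (F i).
  apply: ideal_sum => i _; apply: ideal_M; apply: ideal_span_in; exists (F i).
  by have [/eqP f0 If] := FI i.
apply: dehom_inj => w; rewrite qE dehom_sum; apply: eq_bigr => i _.
rewrite dehom_mul_homogenize; last by have [] := FI i.
congr (_ * _); apply/funext => m; rewrite /dehom /Q; case: ifP => h.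
  by congr (q _ i m); lia.
by rewrite (qO w i) //; case: ifP; lia.
Qed.

(** Multiplication by t shifts the weights by one and leaves the
    dehomogenized components unchanged. *)
Lemma hom_ideal_t_saturated (I : ideal (mps n k)) (g : fps (mps n k)) :
  hom_ideal I (fps_t (mps n k) * g) -> hom_ideal I g.
Proof.
move=> /hom_idealP h; apply/hom_idealP => w.
by rewrite -[w](subrK 1) -dehom_t.
Qed.

Lemma fps_map_t : fps_map (@mps_const n k) (fps_t k) = fps_t (mps n k).
Proof.
by apply/funext => i; rewrite /fps_map /fps_t; case: eqP => _; rewrite ?rmorph1 ?rmorph0.
Qed.

Lemma flat_homR (I : ideal (mps n k)) : flat (homR_str I).
Proof.
apply: flat_of_torsion_free => x; have [g <-] := proj_surj x.
rewrite /= -rmorphM fps_map_t => /proj0 h.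
exact/proj0/hom_ideal_t_saturated.
Qed.

End Division.

(** * The special fibre *)

Lemma inj_surj_bij (A B : choiceType) (f : A -> B) :
  injective f -> (forall y, exists x, f x = y) -> bijective f.
Proof.
move=> inj surj; exists (fun y => projT1 (cid (surj y))) => [x|y].
  by apply: inj; case: cid.
by case: cid.
Qed.

Section PowersInGr.
Variables (R : comNzRingType) (m : ideal R).

Lemma fp0 : val (0 : filtered_poly m) = 0. Proof. exact: (rmorph0 val). Qed.
Lemma fp1 : val (1 : filtered_poly m) = 1. Proof. exact: (rmorph1 val). Qed.
Lemma fpD (p q : filtered_poly m) : val (p + q) = val p + val q.
Proof. exact: (rmorphD val). Qed.
Lemma fpB (p q : filtered_poly m) : val (p - q) = val p - val q.
Proof. exact: (rmorphB val). Qed.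
Lemma fpM (p q : filtered_poly m) : val (p * q) = val p * val q.
Proof. exact: (rmorphM val). Qed.
Lemma fp_sum (T : Type) (r : seq T) (P : pred T) (F : T -> filtered_poly m) :
  val (\sum_(i <- r | P i) F i) = \sum_(i <- r | P i) val (F i).
Proof. exact: (big_morph _ fpD fp0). Qed.

(** An element of m^i is a sum of products of i elements of m, and its class
    in degree i is the sum of the products of their classes in degree 1. *)
Lemma gr_plus_pow_mono i a : ideal_pow m i a -> exists p : filtered_poly m,
  val p = a *: 'X^i /\ ideal_pow (gr_plus m) i (proj (gr_zero m) p).
Proof.
elim: i a => [|i IH] a ha.
  by exists (fp_const m a); rewrite /= expr0 alg_polyC.
elim: ha => [_ [b [c [hb [hc ->]]]]||x y _ [p [pE hp]] _ [q [qE hq]]|r x _ [p [pE hp]]].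
- have bX : b *: 'X \in filtered m.
    apply/asboolP => l; rewrite coefZ coefX; case: l => [|[|l]];
      rewrite ?mulr0 ?mulr1; [exact: ideal_0|exact: ideal_pow1|exact: ideal_0].
  have [p [pE hp]] := IH _ hc.
  exists (FilteredPoly bX * p); split.
    by rewrite fpM pE /= -scalerAl -scalerAr scalerA -exprS.
  rewrite rmorphM; apply: ideal_span_in; exists (proj (gr_zero m) (FilteredPoly bX)).
  exists (proj (gr_zero m) p); split=> //.
  by exists (FilteredPoly bX); rewrite /= coefZ coefX mulr0.
- exists 0; rewrite fp0 rmorph0 scale0r; split=> //; exact: ideal_0.
- exists (p + q); rewrite fpD rmorphD pE qE scalerDl; split=> //; exact: ideal_D.
- exists (fp_const m r * p); split; first by rewrite fpM pE /= mul_polyC scalerA.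
  by rewrite rmorphM; apply: ideal_M.
Qed.

(** The irrelevant ideal is generated in degree 1, so its powers are the steps
    of the filtration by degree. *)
Lemma gr_plus_powP j (p : filtered_poly m) :
  ideal_pow (gr_plus m) j (proj (gr_zero m) p) <->
  forall i, (i < j)%N -> ideal_pow m i.+1 (val p)`_i.
Proof.
split=> [|hp].
  have coef_ideal l : exists J : ideal (gr m), forall g, J g <->
      exists q : filtered_poly m, (forall i, (i < l)%N -> ideal_pow m i.+1 (val q)`_i)
        /\ g = proj (gr_zero m) q.
    pose P (q : filtered_poly m) := forall i, (i < l)%N -> ideal_pow m i.+1 (val q)`_i.
    have P0 : P 0 by move=> i _; rewrite fp0 coef0; apply: ideal_0.
    have PD x y : P x -> P y -> P (x + y).
      by move=> hx hy i hi; rewrite fpD coefD; apply: ideal_D; auto.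
    have PM a x : P x -> P (a * x).
      move=> hx i hi; rewrite fpM coefM; apply: ideal_sum => t _.
      rewrite -[X in ideal_pow m X.+1](subnKC (leq_ord t)) -addnS.
      apply: ideal_pow_mul; first exact: fpP.
      by apply: hx; rewrite (leq_ltn_trans (leq_subr _ _)).
    by exists (image_ideal (@proj_surj _ (gr_zero m)) (Ideal P0 PD PM)).
  (* The components below j depend on the class only, so some representative
     with the property is enough. *)
  suff H l g : ideal_pow (gr_plus m) l g -> exists q : filtered_poly m,
      (forall i, (i < l)%N -> ideal_pow m i.+1 (val q)`_i) /\ g = proj (gr_zero m) q.
    move=> /H[q [hq /proj_eq e]] i hi; have := ideal_D (e i) (hq i hi).
    by rewrite fpB coefB subrK.
  elim: l g => [|l IH] g hg; first by have [q <-] := proj_surj g; exists q.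
  have [J JE] := coef_ideal l.+1; apply/JE; apply: (ideal_gen_sub _ hg).
  move=> {hg} _ [_ [b [[p' [p0 ->]] [/IH[q [hq ->]] ->]]]].
  apply/JE; exists (p' * q); split; last by rewrite rmorphM.
  move=> i hi; rewrite fpM coefM big_ord_recl p0 mul0r add0r.
  apply: ideal_sum => t _; have ht := ltn_ord t; rewrite lift0.
  rewrite -[X in ideal_pow m X.+1](subnKC ht) -addnS.
  by apply: ideal_pow_mul; [exact: fpP | apply: hq; lia].
have mono i : exists q : filtered_poly m, val q = (val p)`_i *: 'X^i /\
    ideal_pow (gr_plus m) i (proj (gr_zero m) q).
  exact/gr_plus_pow_mono/fpP.
pose q i := projT1 (cid (mono i)).
have qE i : val (q i) = (val p)`_i *: 'X^i by rewrite /q; case: cid => ? [].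
have qP i : ideal_pow (gr_plus m) i (proj (gr_zero m) (q i)).
  by rewrite /q; case: cid => ? [].
pose s := \sum_(i < size (val p) | (j <= i)%N) q i.
have -> : proj (gr_zero m) p = proj (gr_zero m) s.
  apply/proj_eq => i; rewrite fpB coefB fp_sum coef_sum.
  under eq_bigr do rewrite qE coefZ coefXn.
  have [hi|hi] := ltnP i j.
    rewrite big1 ?subr0; first exact: hp.
    move=> l hl; case: eqP => [e|]; rewrite ?mulr0 //; lia.
  have [hs|hs] := ltnP i (size (val p)).
    rewrite (bigD1 (Ordinal hs)) //= eqxx mulr1 big1 ?addr0 ?subrr.
      exact: (ideal_0 (ideal_pow m i.+1)).
    move=> l /andP[_ hl]; case: eqP => [e|]; last by rewrite mulr0.
    by case/eqP: hl; apply: val_inj.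
  rewrite nth_default // big1 ?subr0; first exact: ideal_0.
  move=> l _; case: eqP => [e|]; rewrite ?mulr0 //.
  by have := ltn_ord l; lia.
rewrite rmorph_sum; apply: ideal_sum => i hi.
exact: ideal_pow_le hi (qP i).
Qed.

Lemma gr_level_eq j (p q : filtered_poly m) :
  (forall i, (i < j)%N -> ideal_pow m i.+1 ((val p)`_i - (val q)`_i)) ->
  proj (ideal_pow (gr_plus m) j) (proj (gr_zero m) p) =
  proj (ideal_pow (gr_plus m) j) (proj (gr_zero m) q).
Proof.
move=> h; apply/proj_eq; rewrite -rmorphB; apply/gr_plus_powP => i /h.
by rewrite fpB coefB.
Qed.

End PowersInGr.

Section Presentation.
Variables (k : fieldType) (R : comNzRingType) (m : ideal R) (iota : {rmorphism k -> R}).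
Variables (n : nat) (I : ideal (mps n k)) (psi : {rmorphism mps n k -> R}).
Hypothesis psi_surj : forall y, exists x, psi x = y.
Hypothesis psi_ker : forall f, psi f = 0 <-> I f.
Hypothesis psi_const : forall c, psi (mps_const c) = iota c.

Lemma mps_idealP (f : mps n k) : mps_ideal n k f <-> f 0%MM = 0.
Proof.
split=> [/ideal_pow1/pow_order_ge -> //|f0]; first by rewrite mdeg0.
have : ideal_pow (mps_ideal n k) 1 f.
  by apply: order_ge_pow => l; rewrite ltnS leqn0 mdeg_eq0 => /eqP->.
by apply: ideal_gen_sub => _ [a [b [ha [_ ->]]]]; rewrite mulrC; apply: ideal_M.
Qed.

Hypotheses (m_local : local_ring m) (I_sub : forall f, I f -> mps_ideal n k f).

(** S modulo (x_1, ..., x_n) is a field and I is contained in that ideal, so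
    its image in R is maximal; but R has only one maximal ideal. *)
Lemma max_ideal_image x : m x <-> image_ideal psi_surj (mps_ideal n k) x.
Proof.
apply: iff_sym; apply: (proj2 m_local); split.
  move=> [f [/mps_idealP f0 /esym/eqP]].
  rewrite -(rmorph1 psi) -subr_eq0 -rmorphB => /eqP/psi_ker/I_sub/mps_idealP.
  rewrite mpsB f0 sub0r -mps_monom0 /mps_monom eqxx => /eqP.
  by rewrite oppr_eq0 oner_eq0.
move=> K JK; have [|nJ] := pselect (forall x, K x -> image_ideal psi_surj (mps_ideal n k) x).
  by left.
right; apply: contrapT => K1; apply: nJ => y Ky; have [f fE] := psi_surj y.
exists f; split=> //; apply/mps_idealP/eqP/negPn/negP => f0; apply: K1.
have Kc : K (psi (mps_const (f 0%MM))).
  rewrite -[mps_const _](subKr f) rmorphB fE; apply: ideal_B => //.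
  apply: JK; exists (f - mps_const (f 0%MM)); split=> //; apply/mps_idealP.
  by rewrite mpsB /mps_const eqxx subrr.
have := ideal_M (psi (mps_const (f 0%MM)^-1)) Kc.
by rewrite -!rmorphM mulVf // !rmorph1.
Qed.

Lemma max_pow_image i x :
  ideal_pow m i x <-> exists f : mps n k, order_ge i f /\ x = psi f.
Proof.
split=> [hx|[f [hf ->]]].
  have [f [hf e]] := image_ideal_pow (ideal_pow_morph (F := idfun)
    (fun y => proj1 (max_ideal_image y)) hx).
  by exists f; split; [exact: pow_order_ge | exact: e].
apply: (ideal_pow_morph (F := psi) _ (order_ge_pow hf)) => y hy.
by apply/max_ideal_image; exists y.
Qed.

Lemma psi_hcomp_pow i f : ideal_pow m i (psi (hcomp i f)).
Proof. by apply/max_pow_image; exists (hcomp i f); split=> //; apply: hcomp_order_ge. Qed.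

(** The components of f are cut off at degree j because an element of gr(R) has
    only finitely many. *)
Fact gr_trunc_filtered j f :
  fps_trunc j (fps_map psi (dilation f)) \in filtered m.
Proof.
apply/asboolP => i; have [h|h] := ltnP i j.
  by rewrite fps_truncE //; apply: psi_hcomp_pow.
by rewrite coef_poly ltnNge h; apply: ideal_0.
Qed.

Definition gr_trunc j f : filtered_poly m := FilteredPoly (gr_trunc_filtered j f).

Lemma gr_truncE j f i : (i < j)%N -> (val (gr_trunc j f))`_i = psi (hcomp i f).
Proof. by move=> h; rewrite /= fps_truncE. Qed.

Definition gr_level j f : quotient (ideal_pow (gr_plus m) j) :=
  proj _ (proj (gr_zero m) (gr_trunc j f)).

Fact gr_level_zmod j : zmod_morphism (gr_level j).
Proof.
move=> f g; rewrite /gr_level -!rmorphB; apply: gr_level_eq => i hi.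
rewrite fpB coefB !gr_truncE // -!rmorphB.
have -> : hcomp i (f - g) - (hcomp i f - hcomp i g) = 0.
  by apply/eqP; rewrite subr_eq0; apply/eqP/(congr1 (fun u : fps _ => u i) (rmorphB (@dilation n k) f g)).
by rewrite rmorph0; apply: ideal_0.
Qed.
HB.instance Definition _ j := GRing.isZmodMorphism.Build (mps n k) _
  (gr_level j) (@gr_level_zmod j).
Fact gr_level_monoid j : monoid_morphism (gr_level j).
Proof.
split=> [|f g].
  rewrite -(rmorph1 (proj _)) -(rmorph1 (proj (gr_zero m))); apply: gr_level_eq => i hi.
  rewrite gr_truncE // fp1 coef1 -(rmorph1 (@mps_const n k)) hcomp_const.
  by case: eqP => _; rewrite ?rmorph1 ?rmorph0 subrr; apply: ideal_0.
rewrite /gr_level -!rmorphM; apply: gr_level_eq => i hi.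
rewrite fpM [X in _ - X](fps_trunc_mul _ _ hi) gr_truncE // hcompM rmorph_sum.
rewrite /fps_mul -sumrB big1 ?ideal_0 //; first exact: ideal_0.
by move=> l _; rewrite rmorphM subrr.
Qed.
HB.instance Definition _ j := GRing.isMonoidMorphism.Build (mps n k) _
  (gr_level j) (@gr_level_monoid j).

Fact gr_level_compat j f : transition (gr_level j.+1 f) = gr_level j f.
Proof.
rewrite transitionE; apply: gr_level_eq => i hi.
by rewrite !gr_truncE ?(ltnW hi) // ?subrr; [apply: ideal_0|apply: leq_trans hi _].
Qed.

(** f |-> the sum of the classes of its components f_i in m^i / m^(i+1). *)
Definition initial_series : {rmorphism mps n k -> completion (gr_plus m)} :=
  completion_lift gr_level_compat.

Lemma initial_series_eq0 f :
  initial_series f = 0 <-> forall i, ideal_pow m i.+1 (psi (hcomp i f)).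
Proof.
split=> [e i|h].
  have := congr1 (fun u : completion _ => completion_val u i.+1) e.
  move=> /proj0/gr_plus_powP/(_ i (ltnSn i)).
  by rewrite gr_truncE.
apply: completion_eq => j; apply/proj0/gr_plus_powP => i hi.
by rewrite gr_truncE.
Qed.

(** The component of degree i of a given element of the completion can be read
    off at level i + 1 and lifted to S; the homogeneous parts of the lifts make
    up the preimage. *)
Lemma initial_series_surj u : exists f, initial_series f = u.
Proof.
have lift j : exists p : filtered_poly m,
    completion_val u j = proj _ (proj (gr_zero m) p).
  have [g <-] := proj_surj (completion_val u j).
  by have [p <-] := proj_surj g; exists p.
pose p j := projT1 (cid (lift j)).
have pE j : completion_val u j = proj _ (proj (gr_zero m) (p j)).
  by rewrite /p; case: cid.
have lift_coef i : exists s : mps n k, order_ge i s /\ (val (p i.+1))`_i = psi s.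
  exact/max_pow_image/fpP.
pose s i := projT1 (cid (lift_coef i)).
have sO i : order_ge i (s i) by rewrite /s; case: cid => ? [].
have sE i : (val (p i.+1))`_i = psi (s i) by rewrite /s; case: cid => ? [].
exists (fun l => s (mdeg l) l); apply: completion_eq => j; rewrite pE.
apply: gr_level_eq => i hi; rewrite gr_truncE //.
have -> : hcomp i (fun l => s (mdeg l) l) = hcomp i (s i).
  by apply/funext => l; rewrite !hcompE; case: eqP => // ->.
rewrite -[psi _](subrK (val (p i.+1))`_i) -addrA; apply: ideal_D.
  rewrite sE -rmorphB; apply/max_pow_image; exists (hcomp i (s i) - s i); split=> //.
  rewrite -opprB => l hl; have := hcomp_sub_order_ge (sO i) hl.
  by rewrite /GRing.opp /= /mps_opp => ->; rewrite oppr0.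
have := completion_compat hi (pE j); rewrite pE => /proj_eq.
by rewrite -rmorphB => /gr_plus_powP/(_ i (ltnSn i)); rewrite fpB coefB.
Qed.

Definition fps_coef0 (g : fps (mps n k)) : mps n k := g 0%N.
Fact fps_coef0_zmod : zmod_morphism fps_coef0. Proof. by []. Qed.
HB.instance Definition _ := GRing.isZmodMorphism.Build _ _ fps_coef0 fps_coef0_zmod.
Fact fps_coef0_monoid : monoid_morphism fps_coef0.
Proof.
split=> [|f g]; first by rewrite /fps_coef0 fps1.
by rewrite /fps_coef0 fpsM big_ord_recl big_ord0 addr0.
Qed.
HB.instance Definition _ := GRing.isMonoidMorphism.Build _ _ fps_coef0 fps_coef0_monoid.

Let Gamma : {rmorphism fps (mps n k) -> completion (gr_plus m)} :=
  initial_series \o fps_coef0.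

(** Modulo t, hom(f) is the initial form f_o of f; for f in I it is congruent
    to f_o - f, of order greater than o. *)
Lemma initial_series_hom g : hom_ideal I g -> Gamma g = 0.
Proof.
elim=> {g} [_ [f [/eqP f0 [If ->]]]||f g _ ef _ eg|a f _ ef].
- apply/initial_series_eq0 => i; set o := series_order f.
  have -> : hcomp i (fps_coef0 (homogenize f)) = if i == o then hcomp o f else 0.
    apply/funext => l; rewrite /fps_coef0 /homogenize addn0 -/o !hcompE.
    case: (eqVneq i o) => [->|ne]; first by rewrite hcompE; case: eqP.
    by rewrite mps0; case: eqP => // ->; rewrite (negPf ne).
  case: eqP => [->|_]; last by rewrite rmorph0; apply: ideal_0.
  have -> : psi (hcomp o f) = - psi (f - hcomp o f).
    by rewrite rmorphB (proj2 (psi_ker f) If) sub0r opprK.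
  apply: ideal_N; apply/max_pow_image; exists (f - hcomp o f); split=> //.
  by apply: hcomp_sub_order_ge; have [] := series_orderP f0.
- exact: rmorph0.
- by rewrite rmorphD ef eg addr0.
- by rewrite rmorphM ef mulr0.
Qed.

Definition homR_initial : {rmorphism homR I -> completion (gr_plus m)} :=
  quotient_lift initial_series_hom.

Lemma homR_initialE g : homR_initial (homR_proj I g) = initial_series (fps_coef0 g).
Proof. exact: quotient_liftE. Qed.

Lemma homR_str_t : homR_str I (fps_t k) = homR_proj I (fps_t (mps n k)).
Proof. by rewrite /= fps_map_t. Qed.

Lemma homR_initial_t x : homR_t I x -> homR_initial x = 0.
Proof.
elim=> {x} [_ ->||x y _ ex _ ey|a x _ ex].
- rewrite homR_str_t homR_initialE (_ : fps_coef0 _ = 0) ?rmorph0 //.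
- exact: rmorph0.
- by rewrite rmorphD ex ey addr0.
- by rewrite rmorphM ex mulr0.
Qed.

Definition special_initial :
    {rmorphism quotient (homR_t I) -> completion (gr_plus m)} :=
  quotient_lift homR_initial_t.

Lemma special_initialE g :
  special_initial (proj _ (homR_proj I g)) = initial_series (fps_coef0 g).
Proof. by rewrite -homR_initialE; apply: quotient_liftE. Qed.

(** If every homogeneous component of f is an initial form of I, choose
    F_i in I of order at least i with i-th component f_i.  The sum of the
    t^(-i) F_i(tx) lies in hom(I) and reduces to f modulo t. *)
Lemma initial_series_kernel f : initial_series f = 0 ->
  exists2 h, hom_ideal I h & fps_coef0 h = f.
Proof.
move=> /initial_series_eq0 hf.
have lift i : exists F, [/\ I F, order_ge i F & forall l, mdeg l = i -> F l = f l].
  have [e [he psie]] := proj1 (max_pow_image _ _) (hf i).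
  exists (hcomp i f - e); split=> [|l hl|l hl].
  - by apply/psi_ker; rewrite rmorphB psie subrr.
  - by rewrite mpsB he ?(leqW hl) // hcompE ltn_eqF // subrr.
  - by rewrite mpsB he ?hl // hcompE hl eqxx subr0.
pose F i := projT1 (cid (lift i)).
have FI i : I (F i) by rewrite /F; case: cid => ? [].
have FO i : order_ge i (F i) by rewrite /F; case: cid => ? [].
have FE i l : mdeg l = i -> F i l = f l.
  by move=> e; rewrite /F; case: cid => G [_ _ h] /=; apply: h.
pose h : fps (mps n k) := fun j l => if (j <= mdeg l)%N then F (mdeg l - j)%N l else 0.
exists h; last by apply/funext => l; rewrite /fps_coef0 /h subn0; apply: FE.
apply/hom_idealP => -[w|w].
  rewrite (_ : dehom _ h = F w) //; apply/funext => l; rewrite /dehom /h.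
  case: ifP => hw; last by rewrite FO //; lia.
  by rewrite ifT; [congr (F _ l)|]; lia.
rewrite (_ : dehom _ h = 0); first exact: ideal_0.
apply/funext => l; rewrite mps0 /dehom /h; case: ifP => // h1.
by exfalso; lia.
Qed.

Lemma special_initial_bij : bijective special_initial.
Proof.
apply: inj_surj_bij => [|u]; last first.
  have [f <-] := initial_series_surj u.
  by exists (proj _ (homR_proj I (fps_const f))); rewrite special_initialE.
have H p : special_initial p = 0 -> p = 0.
  have [x <-] := proj_surj p; have [g <-] := proj_surj x.
  rewrite [X in X = 0]special_initialE => /initial_series_kernel[h hh e].
  apply/proj0; rewrite (_ : proj _ g = homR_str I (fps_t k) *
      homR_proj I (fun i => g i.+1 - h i.+1)).
    by rewrite mulrC; apply: ideal_M; apply: ideal_span_in.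
  rewrite homR_str_t -rmorphM; apply/proj_eq.
  rewrite (_ : g - _ = h) //; apply/funext => i; rewrite fpsB fps_tM.
  by case: i => [|i]; [rewrite subr0 | rewrite subKr].
by move=> p q e; apply/subr0_eq/H; rewrite rmorphB e subrr.
Qed.

Lemma special_fibre : alg_iso (special_str I) (gr_completion_str m iota).
Proof.
exists special_initial; split=> [|c]; first exact: special_initial_bij.
rewrite [LHS]special_initialE.
apply: completion_eq => j; apply: gr_level_eq => i hi.
rewrite gr_truncE // /= coefC /fps_coef0 /fps_map /fps_const eqxx hcomp_const.
by case: eqP => _; rewrite ?psi_const ?rmorph0 subrr; exact: (ideal_0 (ideal_pow m i.+1)).
Qed.

End Presentation.

(** * The generic fibre *)

Lemma ideal_pow_prod (A : comPzRingType) (J : ideal A) n (b : 'I_n -> A) (m : 'X_{1..n}) :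
  (forall i, J (b i)) -> ideal_pow J (mdeg m) (\prod_(i < n) b i ^+ m i).
Proof.
move=> hb; rewrite mdegE; elim/big_rec2: _ => // i x d _ hx.
apply: ideal_pow_mul hx; elim: (m i) => // e IH; rewrite exprS.
by apply: ideal_span_in; exists (b i), (b i ^+ e).
Qed.

Lemma dilation_homogenize (k : fieldType) n (f : mps n k) : f <> 0 ->
  dilation f = fps_t (mps n k) ^+ series_order f * homogenize f.
Proof.
move=> /series_orderP[hf _]; apply/funext => i; rewrite fps_tnM /dilation.
case: leqP => [/subnKC e|hi]; first by rewrite /homogenize e.
apply/funext => m; rewrite hcompE mps0; case: eqP => // e.
by rewrite hf // e.
Qed.

Lemma fps_map_const (k : comNzRingType) n (c : k) :
  fps_map (@mps_const n k) (fps_const c) = fps_const (mps_const c).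
Proof.
by apply/funext => i; rewrite /fps_map /fps_const; case: eqP.
Qed.

Section GenericFibre.
Variables (k : fieldType) (R : comNzRingType) (iota : {rmorphism k -> R}).
Variables (n : nat) (I : ideal (mps n k)) (phi : {rmorphism quotient I -> R}).
Variable (phi' : R -> quotient I).
Hypotheses (phiK : cancel phi phi') (phi'K : cancel phi' phi).
Hypothesis phi_const : forall c, phi (proj I (mps_const c)) = iota c.

Let A : comPzRingType := homR_generic I.
Let J : ideal A := homR_generic_x I.
Let B : comPzRingType := R_generic iota.
Let J' : ideal B := R_generic_x iota phi.

Let inlA : {rmorphism homR I -> A} := tensor_inl (homR_str I) (fps_laurent k).
Let inrA : {rmorphism laurent k -> A} := tensor_inr (homR_str I) (fps_laurent k).
Let inlB : {rmorphism R -> B} := tensor_inl iota (const_laurent k).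
Let inrB : {rmorphism laurent k -> B} := tensor_inr iota (const_laurent k).
Let psi : {rmorphism mps n k -> R} := phi \o proj I.

Let inlrA a : inlA (homR_str I a) = inrA (fps_laurent k a).
Proof. exact: tensor_ring_inlr. Qed.
Let inlrB c : inlB (iota c) = inrB (const_laurent k c).
Proof. exact: tensor_ring_inlr. Qed.

Definition laurent_tinv : laurent k := Defs.frac (fps_t k) 1 1.

Lemma laurent_tK : fps_laurent k (fps_t k) * laurent_tinv = 1.
Proof.
rewrite [LHS](loc_mulE (fps_t k)); apply/Defs.frac_eq; exists 0%N.
by rewrite /= expr0 !mul1r !mulr1 subrr.
Qed.

(** ** The morphism R -> hom(R) induced by f(x) |-> f(tx) *)

Lemma dilation_hom f : I f -> (homR_proj I \o @dilation n k) f = 0.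
Proof.
move=> If; have [->|/eqP f0] := eqVneq f 0; first by rewrite rmorph0.
rewrite /= dilation_homogenize // rmorphM.
rewrite [X in _ * X](_ : _ = 0) ?mulr0 //; apply/proj0/ideal_span_in.
by exists f; split; [apply/eqP|].
Qed.

Definition dilate_R : {rmorphism R -> homR I} :=
  quotient_lift dilation_hom \o inverse_morphism phiK phi'K.

Lemma dilate_RE f : dilate_R (psi f) = homR_proj I (dilation f).
Proof.
transitivity (quotient_lift dilation_hom (phi' (phi (proj I f)))) => //.
rewrite phiK; exact: quotient_liftE.
Qed.

Lemma homR_str_const c : homR_str I (fps_const c) = homR_proj I (fps_const (mps_const c)).
Proof.
by rewrite /= fps_map_const.
Qed.

Lemma dilate_compat c : (inlA \o dilate_R) (iota c) = inrA (const_laurent k c).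
Proof.
rewrite -phi_const -[RHS]inlrA homR_str_const -dilation_const.
exact: (congr1 inlA (dilate_RE _)).
Qed.

(** The map x |-> tx, from R (x) k((t)) to the generic fibre of hom(R).  It is
    invertible only after completion, since x |-> x/t cannot be applied to
    series with unbounded powers of 1/t. *)
Definition dilate : {rmorphism B -> A} := tensor_ring_lift dilate_compat.

Lemma dilate_inl f : dilate (inlB (psi f)) = inlA (homR_proj I (dilation f)).
Proof.
rewrite [LHS]tensor_ring_liftE rmorph1 mulr1.
exact: (congr1 inlA (dilate_RE _)).
Qed.

Lemma dilate_inr c : dilate (inrB c) = inrA c.
Proof. by rewrite [LHS]tensor_ring_liftE rmorph1 mul1r. Qed.

Lemma mem_J (f : mps n k) : mps_ideal n k f -> J (inlA (homR_S I f)).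
Proof. by move=> hf; apply: ideal_span_in; exists f. Qed.

Lemma mem_J' (f : mps n k) : mps_ideal n k f -> J' (inlB (psi f)).
Proof. by move=> hf; apply: ideal_span_in; exists f. Qed.

Lemma var_mem (i : 'I_n) : mps_ideal n k (mps_var k i).
Proof. by apply: ideal_span_in; exists i. Qed.

Lemma inlA_dilation_var i : inlA (homR_proj I (dilation (mps_var k i))) =
  inrA (fps_laurent k (fps_t k)) * inlA (homR_S I (mps_var k i)).
Proof. by rewrite -inlrA homR_str_t -rmorphM -rmorphM dilation_var. Qed.

Lemma dilate_J b : J' b -> J (dilate b).
Proof.
apply: (ideal_gen_sub (J := preimage_ideal dilate J)) => _ [f [hf ->]].
rewrite /= [X in _ X](dilate_inl f).
have := ideal_gen_sub (J := preimage_ideal (inlA \o homR_proj I \o @dilation n k) J) _ hf.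
apply=> _ [i ->]; rewrite /= inlA_dilation_var.
exact: (@ideal_M _ J _ _ (mem_J (var_mem i))).
Qed.

(** ** The inverse modulo powers of (x_1, ..., x_n): x |-> x / t *)

Section Level.
Variable j : nat.
Let Q : comPzRingType := quotient (ideal_pow J' j).
Let pr : {rmorphism B -> Q} := proj (ideal_pow J' j).
Let theta : {rmorphism fps k -> Q} := pr \o inrB \o fps_laurent k.
Let x_over_t i : B := inlB (psi (mps_var k i)) * inrB laurent_tinv.

Lemma x_over_t_mem i : J' (x_over_t i).
Proof. by rewrite /x_over_t mulrC; apply/ideal_M/mem_J'/var_mem. Qed.

Lemma x_over_t_nilpotent (m : 'X_{1..n}) : (j <= mdeg m)%N ->
  \prod_(i < n) (pr (x_over_t i)) ^+ m i = 0.
Proof.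
move=> hm; transitivity (pr (\prod_(i < n) x_over_t i ^+ m i)).
  by rewrite rmorph_prod; apply: eq_bigr => i _; rewrite rmorphXn.
by apply/proj0/(ideal_pow_le hm)/ideal_pow_prod/x_over_t_mem.
Qed.

(** A series in x over k[[t]] is evaluated at the elements x_i/t, which are
    nilpotent modulo a power of (x_1, ..., x_n). *)
Definition contract_series : {rmorphism mps n (fps k) -> Q} :=
  nilpotent_ev theta x_over_t_nilpotent.

Lemma contract_series_order f : order_ge j f -> contract_series f = 0.
Proof.
move=> hf; rewrite /= /nilpotent_ev big1 // => l _.
by rewrite hf ?bmdeg // rmorph0 mul0r.
Qed.

Lemma contract_series_const a : contract_series (mps_const a) = theta a.
Proof. exact: nilpotent_ev_const. Qed.

Lemma contract_series_var i : contract_series (mps_var _ i) = pr (x_over_t i).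
Proof. exact: nilpotent_ev_var. Qed.

Lemma swap_const a : swap_series (fps_map (@mps_const n k) a) = mps_const a.
Proof.
apply/funext => l; apply/funext => i; rewrite /swap_series /fps_map.
have constE (C : comNzRingType) (c : C) : mps_const c l = if l == 0%MM then c else 0.
  by [].
by rewrite [LHS]constE constE; case: ifP => // _; rewrite fps0.
Qed.

Lemma swap_var (i : 'I_n) :
  swap_series (fps_const (mps_var k i)) = mps_var (fps k) i.
Proof.
apply/funext => l; apply/funext => d; rewrite /swap_series.
have varE (C : comNzRingType) : mps_var C i l = (l == U_(i)%MM)%:R by [].
have constE (C : comNzRingType) (c : C) : fps_const c d = if d == 0%N then c else 0.
  by [].
rewrite constE [RHS](congr1 (fun u : fps k => u d) (varE _)).
rewrite (fun_if (fun u : mps n k => u l)) mps0 varE.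
case: (l == _); last by rewrite if_same [RHS]fps0.
by rewrite [RHS]fps1; case: (d == _).
Qed.

Definition contract_T : {rmorphism fps (mps n k) -> Q} :=
  contract_series \o @swap_series n k.

Lemma contract_T_str a : contract_T (fps_map (@mps_const n k) a) = theta a.
Proof.
transitivity (contract_series (mps_const a)); last exact: contract_series_const.
exact/(congr1 contract_series)/swap_const.
Qed.

Lemma contract_T_var i : contract_T (fps_const (mps_var k i)) = pr (x_over_t i).
Proof.
transitivity (contract_series (mps_var _ i)); last exact: contract_series_var.
exact/(congr1 contract_series)/swap_var.
Qed.

Lemma contract_T_tK : contract_T (fps_t (mps n k)) * pr (inrB laurent_tinv) = 1.
Proof.
rewrite -fps_map_t contract_T_str -[theta _]/(pr (inrB (fps_laurent k (fps_t k)))).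
by rewrite -rmorphM -rmorphM laurent_tK !rmorph1.
Qed.

Lemma contract_dilation f : contract_T (dilation f) = pr (inlB (psi f)).
Proof.
apply: (@mps_morph_eq _ _ _ (contract_T \o @dilation n k) (pr \o inlB \o psi) j).
- move=> g /pow_order_ge hg; apply: contract_series_order => l hl.
  apply/funext => i; transitivity (hcomp i g l) => //.
  by rewrite hcompE hg // fps0 if_same.
- move=> g hg; apply/proj0.
  exact: (ideal_pow_morph (F := inlB \o psi) mem_J' hg).
- move=> a; transitivity (theta (fps_const a)).
    by rewrite -contract_T_str fps_map_const -dilation_const.
  rewrite -[LHS]/(pr (inrB (const_laurent k a))) -inlrB -phi_const.
  by [].
- move=> i; transitivity (contract_T (fps_t (mps n k)) * pr (x_over_t i)).
    by rewrite -contract_T_var -rmorphM -dilation_var.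
  rewrite rmorphM mulrCA contract_T_tK mulr1.
  by [].
Qed.

(** Here t is invertible, so hom(f) vanishes together with
    t^o(f) hom(f) = f(tx), which is mapped to f. *)
Lemma contract_T_hom g : hom_ideal I g -> contract_T g = 0.
Proof.
elim=> {g} [_ [f [/eqP f0 [If ->]]]||f g _ ef _ eg|a f _ ef].
- have : contract_T (dilation f) = 0.
    by rewrite contract_dilation /psi /= (proj2 (proj0 I f) If) !rmorph0.
  rewrite dilation_homogenize // rmorphM rmorphXn.
  elim: (series_order f) => [|o IH]; first by rewrite expr0 mul1r.
  rewrite exprS -mulrA => /(congr1 ( *%R^~ (pr (inrB laurent_tinv)))).
  by rewrite mulrAC contract_T_tK mul1r mul0r => /IH.
- exact: rmorph0.
- by rewrite rmorphD ef eg addr0.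
- by rewrite rmorphM ef mulr0.
Qed.

Definition contract_homR : {rmorphism homR I -> Q} := quotient_lift contract_T_hom.

Lemma contract_homRE g : contract_homR (homR_proj I g) = contract_T g.
Proof. exact: quotient_liftE. Qed.

Lemma contract_compat a : contract_homR (homR_str I a) = (pr \o inrB) (fps_laurent k a).
Proof.
by rewrite [LHS]contract_homRE contract_T_str.
Qed.

Definition contract : {rmorphism A -> Q} := tensor_ring_lift contract_compat.

Lemma contract_inl g : contract (inlA (homR_proj I g)) = contract_T g.
Proof.
rewrite [LHS]tensor_ring_liftE rmorph1 mulr1; exact: contract_homRE.
Qed.

Lemma contract_inr c : contract (inrA c) = pr (inrB c).
Proof. by rewrite [LHS]tensor_ring_liftE rmorph1 mul1r. Qed.

Lemma contract_pow x : ideal_pow J j x -> contract x = 0.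
Proof.
pose K : ideal Q := image_ideal (F := pr) (@proj_surj _ _) J'.
have JK a : J a -> K (contract a).
  apply: (ideal_gen_sub (J := preimage_ideal contract K)) => _ [f [hf ->]].
  have := ideal_gen_sub (J := preimage_ideal (contract \o inlA \o homR_S I) K) _ hf.
  apply=> _ [i ->]; exists (x_over_t i); split; first exact: x_over_t_mem.
  exact: etrans (contract_inl _) (contract_T_var i).
move=> /(ideal_pow_morph JK)/image_ideal_pow[y [hy ->]].
exact/proj0.
Qed.

Lemma contract_dilate b : contract (dilate b) = pr b.
Proof.
apply: (@tensor_ring_eq _ _ _ _ _ _ (contract \o dilate) pr) => [y|c].
  have [f <-] : exists f, psi f = y.
    by have [f e] := proj_surj (phi' y); exists f; rewrite /= e phi'K.
  by rewrite [LHS](congr1 contract (dilate_inl f)) contract_inl contract_dilation.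
by rewrite [LHS](congr1 contract (dilate_inr c)) contract_inr.
Qed.

Let prA : {rmorphism A -> quotient (ideal_pow J j)} := proj (ideal_pow J j).
Let dilateQ : {rmorphism Q -> quotient (ideal_pow J j)} := completion_level dilate_J j.
Let dilateQE b : dilateQ (pr b) = prA (dilate b).
Proof. exact: completion_levelE. Qed.

Let unswap : {rmorphism mps n (fps k) -> fps (mps n k)} :=
  inverse_morphism (@swapK n k) (@unswapK n k).

(** Both sides are morphisms from k[[t]][[x]] that kill a power of
    (x_1, ..., x_n): it is enough to compare them on k[[t]] and on the
    variables, where x_i |-> x_i/t |-> x_i. *)
Lemma dilate_contract_series h :
  dilateQ (contract_series h) = prA (inlA (homR_proj I (unswap h))).
Proof.
have unswap_swap g : unswap (swap_series g) = g by [].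
apply: (@mps_morph_eq _ _ _ (dilateQ \o contract_series)
  (prA \o inlA \o homR_proj I \o unswap) j).
- move=> f /pow_order_ge/contract_series_order e.
  by rewrite [LHS](congr1 dilateQ e) rmorph0.
- move=> f hf; apply/proj0.
  apply: (ideal_pow_morph (F := inlA \o homR_proj I \o unswap) _ hf) => g.
  apply: (ideal_gen_sub (J := preimage_ideal (inlA \o homR_proj I \o unswap) J)).
  by move=> _ [i ->]; rewrite /= -swap_var unswap_swap; apply/mem_J/var_mem.
- move=> a; rewrite [LHS](congr1 dilateQ (contract_series_const a)).
  rewrite [LHS]dilateQE dilate_inr -inlrA.
  by rewrite -swap_const.
- move=> i; rewrite [LHS](congr1 dilateQ (contract_series_var i)).
  rewrite [LHS]dilateQE rmorphM dilate_inl dilate_inr inlA_dilation_var.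
  rewrite mulrAC -rmorphM laurent_tK rmorph1 mul1r -swap_var.
  by [].
Qed.

Lemma dilate_contract a : dilateQ (contract a) = prA a.
Proof.
apply: (@tensor_ring_eq _ _ _ _ _ _ (dilateQ \o contract) prA) => [y|c].
  have [g <-] := proj_surj y.
  rewrite [LHS](congr1 dilateQ (contract_inl g)).
  exact: dilate_contract_series.
by rewrite [LHS](congr1 dilateQ (contract_inr c)) dilateQE dilate_inr.
Qed.

Lemma dilate_inj b : ideal_pow J j (dilate b) -> ideal_pow J' j b.
Proof. by move=> /contract_pow; rewrite contract_dilate => /proj0. Qed.

Lemma dilate_surj a : exists b, ideal_pow J j (a - dilate b).
Proof.
have [b e] := proj_surj (contract a); exists b.
by apply/proj_eq; rewrite -[LHS]dilate_contract -e; apply: dilateQE.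
Qed.

End Level.

Lemma generic_fibre : alg_iso (homR_generic_str I) (R_generic_str iota phi).
Proof.
apply: alg_iso_sym; exists (completion_map dilate_J); split.
  exact: completion_map_bij dilate_inj dilate_surj.
move=> c; apply: completion_eq => j.
rewrite [LHS](completion_levelE dilate_J j (inrB c)).
by rewrite dilate_inr.
Qed.

End GenericFibre.

Theorem theorem2p8 (k : fieldType) (R : comNzRingType) (m : ideal R)
    (iota : {rmorphism k -> R}) (n : nat) (I : ideal (mps n k))
    (phi : {rmorphism quotient I -> R})
    (R_noetherian : noetherian R) (R_local : local_ring m)
    (R_complete : adically_complete m)
    (k_coef : coefficient_field m iota)
    (embdim : cotangent_dim m iota n)
    (I_sub : forall f, I f -> ideal_pow (mps_ideal n k) 2 f)
    (phi_bij : bijective phi)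
    (phi_k : forall c, phi (proj I (mps_const c)) = iota c) :
  [/\ flat (homR_str I),
      alg_iso (special_str I) (gr_completion_str m iota)
    & alg_iso (homR_generic_str I) (R_generic_str iota phi)].
Proof.
have [phi' phiK phi'K] := phi_bij; split; first exact: flat_homR.
  apply: (@special_fibre _ _ _ _ _ _ (phi \o proj I)) => //.
  - move=> y; have [f e] := proj_surj (phi' y).
    by exists f; rewrite /= e phi'K.
  - move=> f; rewrite -proj0 /=; split=> [e|->]; last exact: rmorph0.
    by apply: (can_inj phiK); rewrite e rmorph0.
  - by move=> f /I_sub/pow_order_ge h; apply/mps_idealP/h; rewrite mdeg0.
exact: generic_fibre phiK phi'K phi_k.
Qed.
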